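(* Let $\lambda,\mu\vDash n$ be compositions of $n$. If $\lambda<\mu$ in the refinement order (that is, $\lambda\neq\mu$ and $\lambda$ is a refinement of $\mu$), then $$\xi^{\,l_\mu-l_\lambda}\,b_\mu< b_\lambda .$$
   Context: $S_n$ is the symmetric group with simple reflections $s_i=(i\ \ i+1)$, $1\le i\le n-1$, and length function $\ell$. The Iwahori--Hecke algebra $\mathcal H=\mathcal H_n$ is the associative $\mathbb Z[\xi]$-algebra ($\xi$ an indeterminate) with identity $\tilde T_1$, generated by $\tilde T_{s_1},\dots,\tilde T_{s_{n-1}}$ subject to the braid relations $\tilde T_{s_i}\tilde T_{s_j}=\tilde T_{s_j}\tilde T_{s_i}$ for $|i-j|\ge 2$, $\tilde T_{s_i}\tilde T_{s_{i+1}}\tilde T_{s_i}=\tilde T_{s_{i+1}}\tilde T_{s_i}\tilde T_{s_{i+1}}$, and $\tilde T_{s_i}^2=\tilde T_1+\xi\tilde T_{s_i}$. For a reduced expression $w=s_{i_1}\cdots s_{i_r}$ put $\tilde T_w=\tilde T_{s_{i_1}}\cdots\tilde T_{s_{i_r}}$; the $\tilde T_w$, $w\in S_n$, form a $\mathbb Z[\xi]$-basis. Order: $\mathbb N$ is the set of non-negative integers and $\mathcal H^+=\sum_{w\in S_n}\mathbb N[\xi]\tilde T_w$. For $a,b\in\mathcal H^+$, $a\le b$ means $b-a\in\mathcal H^+$, and $a<b$ means $a\le b$ and $a\ne b$. A composition $\lambda=(\lambda_1,\dots,\lambda_r)$ of $n$ ($\lambda\vDash n$) is a finite sequence of positive integers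 with sum $n$. For compositions, $\lambda$ is a refinement of $\mu$, written $\lambda\le\mu$, if $\lambda=\mu$ or $\mu$ can be obtained from $\lambda$ by adding together adjacent components. $S_\lambda=S_{\lambda_1}\times\cdots\times S_{\lambda_r}\le S_n$ is the standard parabolic subgroup, with $i$-th factor generated by $s_{\lambda_1+\dots+\lambda_{i-1}+1},\dots,s_{\lambda_1+\dots+\lambda_i-1}$ (trivial if $\lambda_i=1$). $\lambda-1$ denotes the composition obtained from $\lambda$ by replacing each $\lambda_i>1$ by the two consecutive entries $\lambda_i-1,1$. The element $w_\lambda\in S_\lambda$ is the product over $i=1,\dots,r$ of $s_{\lambda_1+\dots+\lambda_{i-1}+1}\cdots s_{\lambda_1+\dots+\lambda_i-1}$ (in increasing order of indices; empty product if $\lambda_i=1$), and $l_\lambda=\ell(w_\lambda)$. For standard parabolic subgroups $S_\mu\le S_\lambda$ and $h\in\mathcal H$, the relative norm is $\mathcal N_{S_\lambda,S_\mu}(h)=\sum_{d}\tilde T_{d^{-1}}h\tilde T_d$, the sum over the distinguished (minimal length) representatives $d$ of the right cosets $S_\mu d$ of $S_\mu$ in $S_\lambda$. Put $\eta_\lambda=\mathcal N_{S_{\lambda-1},1}(\tilde T_{w_\lambda})$ and $b_\lambda=\mathcal N_{S_n,S_\lambda}(\eta_\lambda)$ for $\lambda\vDash n$. *)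

(* Defs.v *)
From HB Require Import structures.
From mathcomp Require Import all_boot all_fingroup all_order all_algebra.

Set Implicit Arguments.
Unset Strict Implicit.
Unset Printing Implicit Defensive.

Import Order.TTheory GRing.Theory Num.Theory.

(* Indices are 0-based: 'I_n replaces {1, ..., n}, and the simple reflection   *)
(* usually called s_{i+1} = (i+1 i+2), 1 <= i+1 <= n-1, is [simple i], where   *)
(* i : 'I_n.-1.                                                                *)

Section SymmetricGroup.

Variable n : nat.
Local Open Scope group_scope.

Fact simple_subproof1 (i : 'I_n.-1) : (i < n)%N.
Proof. by case: n i => [[]|m i] //; apply: ltnW; rewrite ltnS. Qed.

Fact simple_subproof2 (i : 'I_n.-1) : (i.+1 < n)%N.
Proof. by case: n i => [[]|m i] //; rewrite ltnS. Qed.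

Definition simple (i : 'I_n.-1) : 'S_n :=
  tperm (Ordinal (simple_subproof1 i)) (Ordinal (simple_subproof2 i)).

Definition word_perm (s : seq 'I_n.-1) : 'S_n := \prod_(i <- s) simple i.

Lemma simple_gen : <<[set simple i | i in 'I_n.-1]>> = [set: 'S_n].
Proof.
case: (posnP n) => [n0|n_gt0].
  apply/eqP; rewrite eqEsubset subsetT /=; apply/subsetP=> w _.
  suff -> : w = 1 by exact: group1.
  by apply/permP=> i; have := ltn_ord i; rewrite {2}n0.
apply/eqP; rewrite eqEsubset subsetT -(gen_tperm (Ordinal n_gt0)) gen_subG.
apply/subsetP=> _ /imsetP[[k k_lt] _ ->].
elim: k k_lt => [|k IHk] k_lt.
  by rewrite (_ : Ordinal k_lt = Ordinal n_gt0) ?tperm1 ?group1 //; apply: val_inj.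
have k_lt' : (k < n.-1)%N by rewrite -ltnS prednK.
have kn := ltnW k_lt.
have s_in : simple (Ordinal k_lt') \in <<[set simple i | i in 'I_n.-1]>>.
  by rewrite mem_gen // imset_f.
have simple1 : simple (Ordinal k_lt') = tperm (Ordinal kn) (Ordinal k_lt).
  by congr tperm; apply: val_inj.
case: (posnP k) => [k0|k_gt0].
  suff <- : Ordinal kn = Ordinal n_gt0 by rewrite -simple1.
  exact: val_inj.
have -> : Ordinal k_lt = simple (Ordinal k_lt') (Ordinal kn).
  by rewrite simple1 tpermL.
have {1}-> : Ordinal n_gt0 = simple (Ordinal k_lt') (Ordinal n_gt0).
  by rewrite simple1 tpermD // -val_eqE /= gtn_eqF.
by rewrite -tpermJ groupJ ?IHk.
Qed.

Lemma exists_word (w : 'S_n) :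
  exists r, [exists t : r.-tuple 'I_n.-1, word_perm t == w].
Proof.
have: w \in <<[set simple i | i in 'I_n.-1]>> by rewrite simple_gen inE.
case/gen_prodgP=> r [c c_in ->]; exists r; apply/existsP.
have c_ex i : exists j, c i == simple j.
  by have /imsetP[j _ ->] := c_in i; exists j.
exists [tuple xchoose (c_ex i) | i < r]; rewrite /word_perm big_tuple.
apply/eqP/eq_bigr => i _; rewrite tnth_mktuple.
by rewrite -(eqP (xchooseP (c_ex i))).
Qed.

(* The least length of an expression of w as a product of simple reflections.  *)
Definition perm_length (w : 'S_n) : nat := ex_minn (exists_word w).

Lemma exists_reduced_word (w : 'S_n) :
  exists t : (perm_length w).-tuple 'I_n.-1, word_perm t == w.
Proof. by apply/existsP; rewrite /perm_length; case: ex_minnP. Qed.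

Definition reduced_word (w : 'S_n) : (perm_length w).-tuple 'I_n.-1 :=
  xchoose (exists_reduced_word w).

(* The minimal length representatives of the right cosets H d contained in G.  *)
Definition min_coset_reps (G H : {set 'S_n}) : {set 'S_n} :=
  [set d in G | [forall x in H :* d, perm_length d <= perm_length x]%N].

End SymmetricGroup.

Section Compositions.

Definition is_composition (n : nat) (l : seq nat) : bool :=
  all (leq 1) l && (sumn l == n).

(* Each block of consecutive parts of l is added up to give one part of m.     *)
Definition refines (l m : seq nat) : Prop :=
  exists bs : seq (seq nat),
    [/\ [::] \notin bs, l = flatten bs & m = map sumn bs].

Definition strictly_refines (l m : seq nat) : Prop := refines l m /\ l <> m.

(* The composition written lambda - 1.                                         *)
Definition comp_pred (l : seq nat) : seq nat :=
  flatten [seq if (1 < a)%N then [:: a.-1; 1] else [:: a] | a <- l].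

Definition psum (l : seq nat) (k : nat) : nat := sumn (take k l).

(* The simple reflections of the k-th factor of the parabolic subgroup are     *)
(* those whose 0-based index i satisfies psum l k <= i <= psum l k.+1 - 2.     *)
Definition in_factor (l : seq nat) (k i : nat) : bool :=
  (psum l k <= i < (psum l k.+1).-1)%N.

Variable n : nat.
Local Open Scope group_scope.

Definition parabolic (l : seq nat) : {set 'S_n} :=
  <<[set simple i | i : 'I_n.-1 & [exists k : 'I_(size l), in_factor l k i]]>>.

(* Products over ordinals are taken in increasing order of the index.          *)
Definition comp_perm (l : seq nat) : 'S_n :=
  \prod_(k < size l) \prod_(i < n.-1 | in_factor l k i) simple i.

Definition comp_length (l : seq nat) : nat := perm_length (comp_perm l).

End Compositions.

Section HeckeAlgebra.

Local Open Scope ring_scope.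

Definition hecke_relations n (A : algType {poly int}) (T : 'I_n.-1 -> A) : Prop :=
  [/\ forall i j : 'I_n.-1, (i.+1 < j)%N -> T i * T j = T j * T i,
      forall i j : 'I_n.-1, j = i.+1 :> nat ->
        T i * T j * T i = T j * T i * T j
    & forall i : 'I_n.-1, T i * T i = 1 + 'X *: T i].

(* H, with generators T, is the Z[xi]-algebra presented by the generators T_i  *)
(* and the Hecke relations; the indeterminate xi is 'X : {poly int}.           *)
Definition is_hecke_algebra n (H : algType {poly int}) (T : 'I_n.-1 -> H) : Prop :=
  hecke_relations T /\
  forall (A : algType {poly int}) (U : 'I_n.-1 -> A), hecke_relations U ->
    exists f : {lrmorphism H -> A},
      (forall i, f (T i) = U i) /\
      (forall g : {lrmorphism H -> A}, (forall i, g (T i) = U i) -> g =1 f).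

Variables (n : nat) (H : algType {poly int}) (T : 'I_n.-1 -> H).

(* By the braid relations this does not depend on the chosen reduced word.     *)
Definition basis_elt (w : 'S_n) : H := \prod_(i <- reduced_word w) T i.

(* N[xi] is the set of integer polynomials with non-negative coefficients.     *)
Definition hecke_nneg (h : H) : Prop :=
  exists2 p : 'S_n -> {poly int},
    forall w, p w \is a polyOver Num.nneg & h = \sum_w p w *: basis_elt w.

Definition hecke_le (a b : H) : Prop :=
  [/\ hecke_nneg a, hecke_nneg b & hecke_nneg (b - a)].

Definition hecke_lt (a b : H) : Prop := hecke_le a b /\ a <> b.

Definition rel_norm (G K : {set 'S_n}) (h : H) : H :=
  \sum_(d in min_coset_reps G K) basis_elt d^-1%g * h * basis_elt d.

Definition hecke_eta (l : seq nat) : H :=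
  rel_norm (parabolic n (comp_pred l)) 1%g (basis_elt (comp_perm n l)).

Definition hecke_b (l : seq nat) : H :=
  rel_norm [set: 'S_n] (parabolic n l) (hecke_eta l).

End HeckeAlgebra.

(* Main.v *)
Require Import Defs.
From HB Require Import structures.
From mathcomp Require Import all_boot all_fingroup all_order all_algebra.
From mathcomp Require Import zify ring.

(** The compositions of n correspond to the sets J of simple reflections: l_lambda
    is #|J|, refinement is inclusion, and w_lambda is the increasing product of J. By
    transitivity of norms and induction on #|K :\: J| it suffices to take K = c |: J
    and to show that the element N_{K,J}(eta_J) - xi eta_K of H_K is nonzero with
    nonnegative coefficients.

    Let tau be the symmetrizing trace, tau(T_x T_y) = [x y = 1]. If h is central in
    H_K, then x |-> tau(h x) is a trace function on H_K. Modulo commutators T_w is an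
    N[xi]-combination of the increasing products T_I, I a subset of K: move to the front
    everything that follows the unique occurrence of the largest generator, and iterate.
    So h is nonnegative as soon as tau(h T_I) is nonnegative for every I.

    The element eta_K is a product of multiplicative Jucys-Murphy elements. This makes
    it central in H_K, and gives tau(eta_K T_I) = [I = K]. On the other side,
    N_{K,J}(eta_J) contains T_{d^-1} T_{w_J} T_d, where d exchanges the two blocks that c
    merges, and this term contains xi times a Coxeter element of the group of K, whose
    coefficient in a central element is that of T_K. *)

Set Implicit Arguments.
Unset Strict Implicit.
Unset Printing Implicit Defensive.

Import Order.TTheory GRing.Theory Num.Theory.

(** * Length and parabolic subgroups *)

Section Length.

Variable n : nat.
Local Open Scope group_scope.
Implicit Types (J K L : {set 'I_n.-1}) (i j : 'I_n.-1) (w d u x y : 'S_n) (r : seq 'I_n.-1).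

(** Nonnegative elements are therefore handled by closure properties, and coefficients become
    readable once tau has been built from the regular representation.

    Testing on increasing products makes the comparison easy: xi eta_K pairs to zero with every T_I
    except I = K, where it gives xi, while the norm N, being nonnegative, pairs nonnegatively with
    everything. Only tau(N T_K) >= xi remains. The factor xi comes from a right descent c' of d:
    T_{d^-1} T_d dominates T_c'^2 = 1 + xi T_c'.

    For strictness, a zero difference would make N pair to zero with T_J, and so with its reversed
    word; but N contains T_J, whose pairing with its reverse is at least 1. Summing preserves this,
    since nonnegative elements cannot cancel. *)

Definition lo i : 'I_n := Ordinal (simple_subproof1 i).
Definition hi i : 'I_n := Ordinal (simple_subproof2 i).

Lemma simpleE i : simple i = tperm (lo i) (hi i). Proof. by []. Qed.

Lemma simpleK i : simple i * simple i = 1.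
Proof. exact: tperm2. Qed.

Lemma simple_mulK i : involutive (fun w : 'S_n => simple i * w).
Proof. by move=> w; rewrite mulgA simpleK mul1g. Qed.

Lemma simple_val i (x : 'I_n) :
  simple i x = (if x == i :> nat then i.+1 else if x == i.+1 :> nat then i : nat else x) :> nat.
Proof.
rewrite simpleE; case: tpermP => [->|->|/eqP + /eqP] /=; rewrite ?eqxx -?val_eqE //=.
- by rewrite gtn_eqF.
- by move=> /negPf-> /negPf->.
Qed.

Lemma simple_far i (x : 'I_n) : x != i :> nat -> x != i.+1 :> nat -> simple i x = x.
Proof. by move=> /negPf h1 /negPf h2; apply: val_inj; rewrite /= simple_val h1 h2. Qed.

(** Products of permutations act from left to right, so this tests whether left multiplication by
    [simple i] lengthens [w]; [~~ asc i w] is a left descent. *)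
Definition asc i w := (w (lo i) < w (hi i))%N.

Lemma ascN i w : ~~ asc i w = (w (hi i) < w (lo i))%N.
Proof.
rewrite /asc -leqNgt leq_eqVlt orbC; case: ltnP => //= h.
apply/negbTE/eqP => /val_inj/perm_inj/(congr1 val)/=; lia.
Qed.

Lemma asc_simple i w : asc i (simple i * w) = ~~ asc i w.
Proof. by rewrite ascN /asc !permM simpleE tpermL tpermR. Qed.

Definition inversions w :=
  [set p : 'I_n * 'I_n | (p.1 < p.2) && (w p.2 < w p.1)]%N.

Definition ninv w := #|inversions w|.

(** Applying s_i to both entries of a pair keeps their order except for the pair (i, i+1), so it
    carries the inversions of [w] to those of [simple i * w] other than that pair. *)
Lemma card_inversions i w :
  asc i w -> ninv (simple i * w) = (ninv w).+1.
Proof.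
rewrite /ninv; move=> h; pose F (p : 'I_n * 'I_n) := (simple i p.1, simple i p.2).
have Fi : injective F by case=> [a b] [c d] [] /perm_inj-> /perm_inj->.
have s2 (a : 'I_n) : simple i (simple i a) = a by rewrite -permM simpleK perm1.
have slt (a b : 'I_n) : (a < b)%N -> ~~ ((a == i :> nat) && (b == i.+1 :> nat)) ->
    (simple i a < simple i b)%N.
  by rewrite !simple_val; do !case: eqP => //; lia.
have -> : inversions (simple i * w) = (lo i, hi i) |: (F @: inversions w).
  apply/setP=> -[a b]; rewrite !inE /= !permM; apply/idP/idP.
  - case/andP=> ab wab; have [/andP[/eqP ea /eqP eb]|nab] :=
      boolP ((a == i :> nat) && (b == i.+1 :> nat)).
      by rewrite xpair_eqE -!val_eqE /= ea eb !eqxx.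
    apply/orP; right; apply/imsetP; exists (simple i a, simple i b).
      by rewrite inE /= wab slt.
    by rewrite /F /= !s2.
  - case/orP=> [/eqP[-> ->]|/imsetP[[a' b']]].
      by rewrite /= ltnSn simpleE tpermL tpermR.
    rewrite inE /= => /andP[ab wab] [-> ->]; rewrite !s2 wab andbT slt //.
    apply/negP=> /andP[/eqP ea /eqP eb]; move: h; rewrite /asc.
    have -> : lo i = a' by apply: val_inj.
    have -> : hi i = b' by apply: val_inj.
    by move: wab; lia.
rewrite cardsU1 card_imset // (_ : _ \notin _) //.
apply/negP=> /imsetP[[a b]]; rewrite inE /= => /andP[ab wab] [ea eb].
have ha : a = hi i by rewrite -[a]s2 -ea simpleE tpermL.
have hb : b = lo i by rewrite -[b]s2 -eb simpleE tpermR.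
by move: ab; rewrite ha hb /=; lia.
Qed.

Lemma inversions1 : ninv 1 = 0.
Proof.
by apply/eqP; rewrite /ninv cards_eq0; apply/eqP/setP=> -[a b]; rewrite !inE !perm1 /=; lia.
Qed.

Lemma card_inversions_word r : (ninv (word_perm r) <= size r)%N.
Proof.
elim: r => [|i r IH]; first by rewrite /word_perm big_nil inversions1.
rewrite /word_perm big_cons -/(word_perm r) /=.
have [h|h] := boolP (asc i (word_perm r)); first by rewrite card_inversions.
have := card_inversions (i := i) (w := simple i * word_perm r).
by rewrite asc_simple h simple_mulK => /(_ isT); lia.
Qed.

(** Counting the missing generators below x numbers the orbits of [par K] from left to right, so
    membership in a parabolic subgroup becomes preservation of one function. *)
Definition blk (K : {set 'I_n.-1}) (x : nat) := #|[set i : 'I_n.-1 | (i \notin K) && (i < x)%N]|.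

Lemma blk_mono K (x y : nat) : (x <= y)%N -> (blk K x <= blk K y)%N.
Proof.
move=> xy; apply/subset_leq_card/subsetP=> i; rewrite !inE => /andP[-> ix].
exact: leq_trans xy.
Qed.

Lemma blkS K i : blk K i.+1 = ((i \notin K) + blk K i)%N.
Proof.
rewrite /blk; have [iK|iK] := boolP (i \in K) => /=.
  rewrite add0n; apply: eq_card=> j; rewrite !inE ltnS leq_eqVlt.
  by case: eqP => [/val_inj->|//]; rewrite iK.
rewrite (_ : [set j | _] = i |: [set j : 'I_n.-1 | (j \notin K) && (j < i)%N]).
  by rewrite cardsU1 inE ltnn andbF.
apply/setP=> j; rewrite !inE ltnS leq_eqVlt val_eqE.
by case: eqP => [->|//]; rewrite iK.
Qed.

Lemma asc_blk (J : {set 'I_n.-1}) d (x y : 'I_n) : (forall i, i \in J -> asc i d) ->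
  (x < y)%N -> blk J x = blk J y -> (d x < d y)%N.
Proof.
move=> h; case: y => y; elim: y => [//|y IH] yn; rewrite ltnS /= => xy e.
have yn' : (y < n.-1)%N by lia.
pose i := Ordinal yn'; have h1 := blk_mono J xy.
have /= h2 := blkS J i; rewrite -e in h2.
have iJ : i \in J by apply/negPn/negP=> iJ; move: h2; rewrite iJ; lia.
have e2 : blk J x = blk J y by rewrite h2 iJ.
have := h _ iJ; rewrite /asc.
have -> : hi i = Ordinal yn by apply: val_inj.
have -> : lo i = Ordinal (ltnW yn) by apply: val_inj.
have [xy'|xy'] := ltnP x y; first by apply: ltn_trans; apply: (IH (ltnW yn)).
suff -> : x = Ordinal (ltnW yn) by [].
by apply: val_inj => /=; lia.
Qed.

(** An increasing permutation satisfies x <= w x, and so does its inverse; together these force w =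
    1. *)
Lemma all_asc_eq1 w : (forall i, asc i w) -> w = 1.
Proof.
move=> h; have mono (x y : 'I_n) : (x < y)%N -> (w x < w y)%N.
  move=> xy; apply: (@asc_blk setT) => //; rewrite /blk.
  by apply: eq_card=> i; rewrite !inE.
have ge (v : 'S_n) : (forall x y : 'I_n, (x < y)%N -> (v x < v y)%N) ->
    forall x : 'I_n, (x <= v x)%N.
  move=> vm [x]; elim: x => [//|x IH] xn /=.
  by have := IH (ltnW xn); have := vm (Ordinal (ltnW xn)) (Ordinal xn) (ltnSn _) => /=; lia.
have monoV (x y : 'I_n) : (x < y)%N -> (w^-1 x < w^-1 y)%N.
  move=> xy; rewrite ltnNge leq_eqVlt; apply/negP=> /orP[/eqP/val_inj/perm_inj e|].
    by move: xy; rewrite e ltnn.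
  by move/mono; rewrite !permKV; lia.
apply/permP=> x; rewrite perm1; apply: val_inj => /=.
have := ge _ mono x; have := ge _ monoV (w x); rewrite permK; lia.
Qed.

Lemma word_perm_cons i r : word_perm (i :: r) = simple i * word_perm r.
Proof. by rewrite /word_perm big_cons. Qed.

Lemma word_perm_cat r1 r2 : word_perm (r1 ++ r2) = word_perm r1 * word_perm r2.
Proof. by rewrite /word_perm big_cat. Qed.

Lemma word_perm_rev r : word_perm (rev r) = (word_perm r)^-1.
Proof.
elim: r => [|i r IH]; first by rewrite /word_perm big_nil invg1.
rewrite rev_cons -cats1 word_perm_cat IH [word_perm (i :: r)]word_perm_cons invMg; congr (_ * _).
by rewrite /word_perm big_seq1 /simple tpermV.
Qed.

Lemma blk_simple K i (x : 'I_n) : i \in K -> blk K (simple i x) = blk K x.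
Proof.
move=> iK; have h := blkS K i; rewrite iK /= add0n in h.
by rewrite simple_val; case: eqP => [->|_]; [|case: eqP => [->|]].
Qed.

(** Bubble sort: stripping a left descent removes one inversion. At a generator outside K two
    successive blocks meet, and [w] cannot reverse them, so every letter lies in K. The word serves
    both to identify the length and to find reduced words inside [par K]. *)
Lemma blk_word K w : (forall x : 'I_n, blk K (w x) = blk K x) ->
  exists r, [/\ {subset r <= K}, word_perm r = w & size r = ninv w ].
Proof.
move: {2}(ninv w) (leqnn (ninv w)) => N; elim: N w => [|N IH] w wN wK;
  (have [h|/existsP[i]] := boolP [forall i, asc i w];
   [exists [::]; have -> := all_asc_eq1 (forallP h);
    by split=> //; [rewrite /word_perm big_nil | rewrite inversions1]|]) => ni.
  have := card_inversions (i := i) (w := simple i * w).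
  by rewrite asc_simple simple_mulK ni => /(_ isT); lia.
have := card_inversions (i := i) (w := simple i * w).
rewrite asc_simple simple_mulK ni => /(_ isT) e.
have iK : i \in K.
  apply/negPn/negP=> iK; have := blkS K i; rewrite iK.
  have := wK (lo i); have := wK (hi i); rewrite /= => <- <-.
  by have := blk_mono K (ltnW (_ : w (hi i) < w (lo i))%N); rewrite -ascN ni => /(_ isT); lia.
case: (IH (simple i * w)) => [|x|r [rK rw rs]]; first by lia.
  by rewrite permM wK blk_simple.
exists (i :: r); split; last by rewrite /= rs e.
  by move=> j; rewrite inE => /orP[/eqP->//|/rK].
by rewrite word_perm_cons rw simple_mulK.
Qed.

Lemma perm_lengthE w : perm_length w = ninv w.
Proof.
have [|r [_ rw rs]] := @blk_word setT w.
  by move=> x; apply: eq_card=> i; rewrite !inE.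
rewrite /perm_length; case: ex_minnP => m /existsP[t /eqP tw] hm.
apply/eqP; rewrite eqn_leq; apply/andP; split; last first.
  by have := card_inversions_word t; rewrite tw size_tuple.
by rewrite -rs; apply: hm; apply/existsP; exists (in_tuple r); rewrite rw.
Qed.

Lemma length_asc i w : asc i w -> perm_length (simple i * w) = (perm_length w).+1.
Proof. by rewrite !perm_lengthE; exact: card_inversions. Qed.

Lemma length_desc i w : ~~ asc i w -> perm_length w = (perm_length (simple i * w)).+1.
Proof. by move=> h; rewrite -(@length_asc i) ?asc_simple // simple_mulK. Qed.

Lemma length_word r : (perm_length (word_perm r) <= size r)%N.
Proof. by rewrite perm_lengthE card_inversions_word. Qed.

Lemma length1 : perm_length (1 : 'S_n) = 0.
Proof. by rewrite perm_lengthE inversions1. Qed.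

Lemma length_eq0 w : (perm_length w == 0) = (w == 1).
Proof.
apply/eqP/eqP=> [h|->]; last exact: length1.
by apply: all_asc_eq1 => i; apply/negPn/negP=> /length_desc; rewrite h.
Qed.

Lemma reduced_wordP w : exists2 r, word_perm r = w & size r = perm_length w.
Proof.
have [t /eqP tw] := exists_reduced_word w; exists t => //; exact: size_tuple.
Qed.

Lemma lengthV w : perm_length w^-1 = perm_length w.
Proof.
suff le x : (perm_length x^-1 <= perm_length x)%N.
  by apply/eqP; rewrite eqn_leq le -{1}(invgK w) le.
have [r rw rs] := reduced_wordP x.
by rewrite -rw -word_perm_rev rw -rs -(size_rev r) length_word.
Qed.

Definition par (K : {set 'I_n.-1}) : {group 'S_n} :=
  <<[set simple i | i in K]>>%G.

Lemma simple_par K i : i \in K -> simple i \in par K.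
Proof. by move=> iK; rewrite mem_gen // imset_f. Qed.

Lemma word_par K r : {subset r <= K} -> word_perm r \in par K.
Proof.
by move=> rK; rewrite /word_perm big_seq group_prod // => i /rK; apply: simple_par.
Qed.

Lemma parP K w : reflect (forall x : 'I_n, blk K (w x) = blk K x) (w \in par K).
Proof.
apply: (iffP idP) => [|/blk_word[r [rK <- _]]]; last exact: word_par.
pose G := [set w : 'S_n | [forall x : 'I_n, blk K (w x) == blk K x]].
have GP (v : 'S_n) : reflect (forall x : 'I_n, blk K (v x) = blk K x) (v \in G).
  by rewrite inE; apply: (iffP forallP) => h x; apply/eqP.
have gG : group_set G.
  apply/group_setP; split; first by apply/GP=> x; rewrite perm1.
  by move=> v1 v2 /GP h1 /GP h2; apply/GP=> x; rewrite permM h2.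
suff /subsetP sG : par K \subset Group gG by move/sG/GP.
rewrite gen_subG; apply/subsetP=> _ /imsetP[i iK ->]; apply/GP=> x.
exact: blk_simple.
Qed.

Lemma par_reduced_word K w : w \in par K ->
  exists r, [/\ {subset r <= K}, word_perm r = w & size r = perm_length w].
Proof. by move/parP/blk_word=> [r [h1 h2 h3]]; exists r; rewrite perm_lengthE. Qed.

Lemma parS J K : J \subset K -> par J \subset par K.
Proof. by move=> JK; apply: genS; apply: imsetS. Qed.

Lemma par0 : par set0 = 1 :> {set 'S_n}.
Proof. by rewrite /par imset0 /= gen0. Qed.

Lemma parT : par setT = [set: 'S_n] :> {set 'S_n}.
Proof.
by rewrite -simple_gen /=; congr generated; apply/setP=> x;
apply/imsetP/imsetP=> -[i _ ->]; exists i; rewrite ?inE.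
Qed.

(** [d] increases on every block of J, so an ascent of an element of [par J] stays an ascent after
    multiplication by [d]; the letters of a reduced word of [u] are then added one at a time. *)
Lemma length_mul_reps (J : {set 'I_n.-1}) u d : u \in par J -> (forall i, i \in J -> asc i d) ->
  perm_length (u * d) = (perm_length u + perm_length d)%N.
Proof.
move=> uJ dJ; have [r [rJ]] := par_reduced_word uJ.
elim: r u uJ rJ => [|i r IH] u uJ rJ <- rs.
  by rewrite /word_perm big_nil mul1g length1.
have rJ' : {subset r <= J} by move=> j jr; apply: rJ; rewrite inE jr orbT.
have iJ : i \in J by apply: rJ; rewrite inE eqxx.
rewrite word_perm_cons in rs *.
have h : asc i (word_perm r).
  by apply/negPn/negP=> /length_desc; have := length_word r; move: rs => /=; lia.
move: rs; rewrite -mulgA (length_asc h) /= => -[rs].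
rewrite length_asc ?IH ?addSn // ?word_par //.
rewrite /asc !permM; apply: asc_blk dJ h _.
have /parP hr := word_par rJ'; rewrite !hr /= blkS iJ //.
Qed.

(** If [d] ascends along J, lengths add in every [u * d] with [u] in [par J], so [d] is shortest in
    its coset; a descent in J would give a shorter element of the same coset. *)
Lemma mem_reps J K d :
  d \in min_coset_reps (par K) (par J) <-> d \in par K /\ forall i, i \in J -> asc i d.
Proof.
split=> [|[dK dJ]].
  rewrite inE => /andP[-> /forall_inP h]; split=> // i iJ.
  apply/negPn/negP=> /length_desc; have := h (simple i * d).
  rewrite mem_rcoset mulgK simple_par // => /(_ isT); lia.
rewrite inE dK; apply/forall_inP=> x; rewrite mem_rcoset => xd.
by rewrite -(mulgKV d x) (length_mul_reps xd) // leq_addl.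
Qed.

Lemma one_reps J K : 1 \in min_coset_reps (par K) (par J).
Proof. by apply/mem_reps; split=> [|i _]; rewrite ?group1 // /asc !perm1 /=. Qed.

Lemma reps_exists J K w : J \subset K -> w \in par K ->
  exists u d, [/\ u \in par J, d \in min_coset_reps (par K) (par J) & w = u * d].
Proof.
move=> JK wK; have ww : w \in par J :* w by exact: rcoset_refl.
case: (arg_minnP (P := fun x => x \in par J :* w) (@perm_length n) ww) => d.
rewrite mem_rcoset => dw hd; exists (w * d^-1), d; split; last by rewrite mulgKV.
  by rewrite -groupV invMg invgK.
apply/mem_reps; split=> [|i iJ].
  by rewrite -(mulgKV w d) groupM // (subsetP (parS JK)).
apply/negPn/negP=> /length_desc; have := hd (simple i * d).
rewrite mem_rcoset -mulgA groupM ?simple_par // => /(_ isT); lia.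
Qed.

(** With v = u1^-1 u2, lengths add in both d1 = v d2 and d2 = v^-1 d1, which forces v to have length
    0. *)
Lemma reps_unique (J : {set 'I_n.-1}) u1 u2 d1 d2 : u1 \in par J -> u2 \in par J ->
  (forall i, i \in J -> asc i d1) -> (forall i, i \in J -> asc i d2) ->
  u1 * d1 = u2 * d2 -> u1 = u2 /\ d1 = d2.
Proof.
move=> u1J u2J h1 h2 e.
have e1 : d1 = (u1^-1 * u2) * d2 by rewrite -mulgA -e mulKg.
have e2 : d2 = (u1^-1 * u2)^-1 * d1 by rewrite e1 mulKg.
have uJ : u1^-1 * u2 \in par J by rewrite groupM ?groupV.
have := length_mul_reps uJ h2; rewrite -e1.
have uJ' : (u1^-1 * u2)^-1 \in par J by rewrite groupV.
have := length_mul_reps uJ' h1; rewrite -e2 lengthV => l1 l2.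
have /eqP : perm_length (u1^-1 * u2) = 0 by lia.
rewrite length_eq0 => /eqP u0; split; last by rewrite e1 u0 mul1g.
by rewrite -(mulg1 u1) -u0 mulKVg.
Qed.

Lemma reps_mul J K L d e : J \subset K -> K \subset L ->
  e \in min_coset_reps (par K) (par J) -> d \in min_coset_reps (par L) (par K) ->
  e * d \in min_coset_reps (par L) (par J).
Proof.
move=> JK KL /mem_reps[eK eJ] /mem_reps[dL dK]; apply/mem_reps; split.
  by rewrite groupM // (subsetP (parS KL)).
move=> i iJ; rewrite /asc !permM; apply: asc_blk dK (eJ _ iJ) _.
by move/parP: eK => eK; rewrite !eK /= blkS (subsetP JK).
Qed.

Lemma reps_split J K L x : J \subset K -> K \subset L ->
  x \in min_coset_reps (par L) (par J) -> exists e d,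
  [/\ e \in min_coset_reps (par K) (par J), d \in min_coset_reps (par L) (par K)
    & x = e * d].
Proof.
move=> JK KL /mem_reps[xL xJ].
have [e [d [eK dK xe]]] := reps_exists KL xL.
exists e, d; split=> //; apply/mem_reps; split=> // i iJ.
apply/negPn/negP; rewrite ascN => h; move/mem_reps: dK => [_ dK].
have := xJ _ iJ; rewrite xe /asc !permM.
suff: (d (e (hi i)) < d (e (lo i)))%N by lia.
by apply: asc_blk dK h _; move/parP: eK => eK; rewrite !eK /= blkS (subsetP JK).
Qed.

End Length.

(** * Braid relations among simple reflections *)

Section Braid.
Variable n : nat.
Local Open Scope group_scope.
Implicit Types (i j : 'I_n.-1) (w : 'S_n).

Lemma simple_comm i j : (i.+1 < j)%N -> simple i * simple j = simple j * simple i.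
Proof.
by move=> ij; apply/permP=> x; apply: val_inj; rewrite /= !permM !simple_val;
  do !case: eqP => //; lia.
Qed.

Lemma simple_braid i j : j = i.+1 :> nat ->
  simple i * simple j * simple i = simple j * simple i * simple j.
Proof.
by move=> ij; apply/permP=> x; apply: val_inj; rewrite /= !permM !simple_val;
  do !case: eqP => //; lia.
Qed.

Lemma asc_far i j w : (i.+1 < j)%N || (j.+1 < i)%N -> asc j (simple i * w) = asc j w.
Proof. by move=> ij; rewrite /asc !permM !(simple_far (i := i)) //=; lia. Qed.

(** Descents at both i and j make [w] decreasing on three consecutive points, so the longest element
    of the group generated by s_i and s_j can be stripped from the left. *)
Lemma asc_adj i j w : j = i.+1 :> nat -> ~~ asc i w -> ~~ asc j w ->
  ~~ asc j (simple i * w) /\ ~~ asc i (simple j * (simple i * w)).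
Proof.
move=> ij; have e : hi i = lo j by apply: val_inj; rewrite /= ij.
have f1 : simple j (lo i) = lo i by apply: simple_far => /=; lia.
have f2 : simple i (hi j) = hi j by apply: simple_far => /=; lia.
have f3 : simple i (lo j) = lo i by rewrite -e simpleE tpermR.
have f4 : simple j (lo j) = hi j by rewrite simpleE tpermL.
have f5 : simple i (lo i) = lo j by rewrite simpleE tpermL.
have f6 : simple j (hi j) = lo j by rewrite simpleE tpermR.
by rewrite !ascN !permM !e !(f1, f2, f3, f4, f5, f6); split; lia.
Qed.

End Braid.

Local Open Scope ring_scope.

Local Notation nneg p := (p \is a polyOver Num.nneg).

Section Nonneg.
Implicit Types p q : {poly int}.

Lemma nnegP p : reflect (forall k, 0 <= p`_k) (nneg p).
Proof. exact: (iffP polyOverP). Qed.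

Lemma nnegD p q : nneg p -> nneg q -> nneg (p + q).
Proof. by move=> /nnegP hp /nnegP hq; apply/nnegP=> k; rewrite coefD addr_ge0. Qed.

Lemma nnegM p q : nneg p -> nneg q -> nneg (p * q).
Proof.
move=> /nnegP hp /nnegP hq; apply/nnegP=> k; rewrite coefM sumr_ge0 // => i _.
by rewrite mulr_ge0.
Qed.

Lemma nneg_nat (m : nat) : nneg (m%:R : {poly int}).
Proof. by apply/nnegP=> k; rewrite -polyC_natr coefC; case: eqP => // _; rewrite ler0n. Qed.

Lemma nneg0 : nneg (0 : {poly int}). Proof. exact: (nneg_nat 0). Qed.
Lemma nneg1 : nneg (1 : {poly int}). Proof. exact: (nneg_nat 1). Qed.

Lemma nnegX : nneg ('X : {poly int}).
Proof. by apply/nnegP=> k; rewrite coefX ler0n. Qed.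

Lemma nneg_add_eq0 p q : nneg p -> nneg q -> p + q = 0 -> p = 0.
Proof.
move=> /nnegP hp /nnegP hq e; apply/polyP=> k; rewrite coef0.
have := congr1 (fun r : {poly int} => r`_k) e; rewrite coefD coef0.
by have := hp k; have := hq k; lia.
Qed.

End Nonneg.

(** * The standard basis and nonnegative elements *)

Section Hecke.

Variables (n : nat) (H : algType {poly int}) (T : 'I_n.-1 -> H).
Hypothesis relT : hecke_relations T.
Implicit Types (J K L : {set 'I_n.-1}) (i j : 'I_n.-1) (w d u x y : 'S_n) (r s t : seq 'I_n.-1).

Definition word_elt s : H := \prod_(i <- s) T i.
Notation Tw := (basis_elt T).

Lemma T_far i j : (i.+1 < j)%N || (j.+1 < i)%N -> T i * T j = T j * T i.
Proof. by case: relT => h _ _ /orP[/h|/h ->]. Qed.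

Lemma T_braid i j : j = i.+1 :> nat -> T i * T j * T i = T j * T i * T j.
Proof. by case: relT => _ h _; apply: h. Qed.

Lemma T_sqr i : T i * T i = 1 + 'X *: T i.
Proof. by case: relT => _ _ h; apply: h. Qed.

Lemma word_elt_cons i s : word_elt (i :: s) = T i * word_elt s.
Proof. by rewrite /word_elt big_cons. Qed.

Lemma word_elt_nil : word_elt [::] = 1.
Proof. by rewrite /word_elt big_nil. Qed.

Lemma word_elt_cat s t : word_elt (s ++ t) = word_elt s * word_elt t.
Proof. by rewrite /word_elt big_cat. Qed.

Lemma word_elt1 i : word_elt [:: i] = T i.
Proof. by rewrite /word_elt big_seq1. Qed.

Lemma reduced_desc i s : perm_length (word_perm (i :: s)) = (size s).+1 ->
  ~~ asc i (word_perm (i :: s)).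
Proof.
move=> h; apply/negP=> /length_asc; rewrite h word_perm_cons simple_mulK.
by have := length_word s; lia.
Qed.

(* Two reduced words of w starting with i and j can be compared through words
   of w starting with a common longest element of <s_i, s_j>. *)
Lemma matsumoto s t : word_perm s = word_perm t -> size s = size t ->
  perm_length (word_perm s) = size s -> word_elt s = word_elt t.
Proof.
move: {2}(size s) (leqnn (size s)) => N; elim: N s t => [|N IH] [|i s] [|j t] //= sN e [es] l.
have di : ~~ asc i (word_perm (i :: s)) by apply: reduced_desc.
have dj : ~~ asc j (word_perm (i :: s)) by rewrite e; apply: reduced_desc; rewrite -e -es.
set w := word_perm (i :: s) in e l di dj.
have ws : word_perm s = (simple i * w)%g by rewrite /w word_perm_cons simple_mulK.
have wt : word_perm t = (simple j * w)%g by rewrite e word_perm_cons simple_mulK.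
have ls : perm_length (word_perm s) = size s.
  by have := length_desc di; rewrite -ws l; lia.
have lt : perm_length (word_perm t) = size t.
  by have := length_desc dj; rewrite -wt l; lia.
have IHs r : word_perm r = word_perm s -> size r = size s -> word_elt s = word_elt r.
  by move=> e1 e2; apply: IH => //; rewrite ?e2 //; lia.
have IHt r : word_perm r = word_perm t -> size r = size t -> word_elt t = word_elt r.
  by move=> e1 e2; apply: IH => //; rewrite ?e2 //; lia.
rewrite !word_elt_cons.
have [eij|nij] := eqVneq i j.
  by rewrite -eij; congr (_ * _); apply: IHs; rewrite // wt ws eij.
have [far|near] := boolP ((i.+1 < j)%N || (j.+1 < i)%N).
  have dji : ~~ asc j (simple i * w)%g by rewrite asc_far.
  have [r wr lr] := reduced_wordP (simple j * (simple i * w))%g.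
  have := length_desc dji; rewrite -lr -ws ls => lr'.
  have sC : (simple i * simple j = simple j * simple i)%g.
    by case/orP: far => /simple_comm.
  have e1 : word_elt s = word_elt (j :: r).
    by apply: IHs; [rewrite word_perm_cons wr ws simple_mulK | rewrite /= -lr'].
  have e2 : word_elt t = word_elt (i :: r).
    apply: IHt; last by rewrite /= -lr'.
    by rewrite word_perm_cons wr wt mulgA sC -mulgA simple_mulK.
  by rewrite e1 e2 !word_elt_cons !mulrA (T_far far).
have adj (a b : 'I_n.-1) : b = a.+1 :> nat -> ~~ asc a w -> ~~ asc b w ->
    exists r, [/\ word_perm (b :: a :: r) = (simple a * w)%g,
      word_perm (a :: b :: r) = (simple b * w)%g & perm_length w = (size r).+3].
  move=> ab da db; have [h1 h3] := asc_adj ab da db.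
  have [r wr lr] := reduced_wordP (simple a * (simple b * (simple a * w)))%g.
  exists r; rewrite !word_perm_cons wr lr; split.
  - by rewrite !simple_mulK.
  - rewrite (_ : simple a * (simple b * (simple a * w)) =
        simple b * (simple a * (simple b * w)))%g.
      by rewrite !simple_mulK.
    by rewrite !mulgA (simple_braid ab).
  - by rewrite (length_desc da) (length_desc h1) (length_desc h3).
have [ij|ji] : (j = i.+1 :> nat \/ i = j.+1 :> nat).
  by move: near nij; rewrite -val_eqE /=; lia.
- have [r [e1 e2 e3]] := adj _ _ ij di dj.
  have f1 : word_elt s = word_elt (j :: i :: r).
    by apply: IHs; [rewrite e1 ws | move: l; rewrite e3 => -[]].
  have f2 : word_elt t = word_elt (i :: j :: r).
    by apply: IHt; [rewrite e2 wt | rewrite -es; move: l; rewrite e3 => -[]].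
  by rewrite f1 f2 !word_elt_cons !mulrA (T_braid ij).
- have [r [e1 e2 e3]] := adj _ _ ji dj di.
  have f1 : word_elt s = word_elt (j :: i :: r).
    by apply: IHs; [rewrite e2 ws | move: l; rewrite e3 => -[]].
  have f2 : word_elt t = word_elt (i :: j :: r).
    by apply: IHt; [rewrite e1 wt | rewrite -es; move: l; rewrite e3 => -[]].
  by rewrite f1 f2 !word_elt_cons !mulrA (T_braid ji).
Qed.

Lemma basis_elt_word s : perm_length (word_perm s) = size s ->
  Tw (word_perm s) = word_elt s.
Proof.
move=> h; rewrite /basis_elt -/(word_elt _); apply: matsumoto.
- exact/eqP/(xchooseP (exists_reduced_word _)).
- by rewrite size_tuple.
- by rewrite size_tuple; congr perm_length;
    apply/eqP/(xchooseP (exists_reduced_word _)).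
Qed.

Lemma basis_eltM x y : perm_length (x * y)%g = (perm_length x + perm_length y)%N ->
  Tw (x * y)%g = Tw x * Tw y.
Proof.
have [r <- lr] := reduced_wordP x; have [t <- lt] := reduced_wordP y.
rewrite -lr -lt -word_perm_cat -size_cat => /basis_elt_word->.
by rewrite !basis_elt_word // word_elt_cat.
Qed.

Lemma basis_elt1 : Tw 1%g = 1.
Proof.
have := @basis_elt_word [::]; rewrite /word_perm /word_elt !big_nil; apply.
exact: length1.
Qed.

Lemma length_simple i : perm_length (simple i) = 1%N.
Proof.
have := @length_asc n i 1%g; rewrite mulg1 length1; apply.
by rewrite /asc !perm1 /=.
Qed.

Lemma basis_elt_simple i : Tw (simple i) = T i.
Proof.
have := @basis_elt_word [:: i]; rewrite word_elt1 /word_perm big_seq1; apply.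
exact: length_simple.
Qed.

Lemma T_basis_asc i w : asc i w -> T i * Tw w = Tw (simple i * w)%g.
Proof.
move=> h; rewrite basis_eltM ?basis_elt_simple //.
by rewrite length_asc // length_simple.
Qed.

Lemma simpleV i : (simple i)^-1%g = simple i.
Proof. exact: tpermV. Qed.

Lemma basis_T_asc i w : asc i w^-1%g -> Tw w * T i = Tw (w * simple i)%g.
Proof.
move=> h; rewrite basis_eltM ?basis_elt_simple //.
by rewrite -lengthV invMg simpleV length_asc // lengthV length_simple addn1.
Qed.

Lemma basis_T_desc i w : ~~ asc i w^-1%g ->
  Tw w * T i = Tw (w * simple i)%g + 'X *: Tw w.
Proof.
move=> h; have h' : asc i (w * simple i)^-1%g by rewrite invMg simpleV asc_simple.
have e : Tw w = Tw (w * simple i)%g * T i.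
  by rewrite basis_T_asc // -mulgA simpleK mulg1.
by rewrite {1}e -mulrA T_sqr mulrDr mulr1 -scalerAr -e.
Qed.

(** The nonnegative elements of the subalgebra H_K. The coefficients are only asserted to exist;
    their uniqueness comes later, from the trace. *)
Definition cone K (h : H) := exists2 p : 'S_n -> {poly int},
  (forall w, nneg (p w)) /\ (forall w, w \notin par K -> p w = 0)
  & h = \sum_w p w *: Tw w.

Lemma cone_nneg h : cone setT h <-> hecke_nneg T h.
Proof.
split=> [[p [p0 _] ->]|[p p0 ->]]; first by exists p.
by exists p => //; split=> // w; rewrite /par /= parT inE.
Qed.

Lemma cone0 K : cone K 0.
Proof.
exists (fun=> 0); first by split=> // w; exact: nneg0.
by rewrite big1 // => w _; rewrite scale0r.
Qed.

Lemma coneD K a b : cone K a -> cone K b -> cone K (a + b).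
Proof.
move=> [p [p0 pK] ->] [q [q0 qK] ->]; exists (fun w => p w + q w).
  by split=> w => [|wK]; rewrite ?nnegD // pK // qK // addr0.
by rewrite -big_split; apply: eq_bigr => w _; rewrite scalerDl.
Qed.

Lemma coneZ K c a : nneg c -> cone K a -> cone K (c *: a).
Proof.
move=> c0 [p [p0 pK] ->]; exists (fun w => c * p w).
  by split=> w => [|wK]; rewrite ?nnegM // pK // mulr0.
by rewrite scaler_sumr; apply: eq_bigr => w _; rewrite scalerA.
Qed.

Lemma cone_sum K (I : Type) (r : seq I) (P : pred I) (F : I -> H) :
  (forall i : I, P i -> cone K (F i)) -> cone K (\sum_(i <- r | P i) F i).
Proof. by move=> h; apply: big_ind => //; [exact: cone0 | move=> *; exact: coneD]. Qed.

Lemma cone_basis K w : w \in par K -> cone K (Tw w).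
Proof.
move=> wK; exists (fun v => (v == w)%:R).
  split=> v; first by rewrite nneg_nat.
  by case: eqP => // ->; rewrite wK.
rewrite (bigD1 w) //= eqxx scale1r big1 ?addr0 // => v /negPf->.
by rewrite scale0r.
Qed.

Lemma cone_ind K (Q : H -> Prop) :
  Q 0 -> (forall a b, Q a -> Q b -> Q (a + b)) ->
  (forall c a, nneg c -> Q a -> Q (c *: a)) ->
  (forall w, w \in par K -> Q (Tw w)) -> forall h, cone K h -> Q h.
Proof.
move=> Q0 QD QZ QT h [p [p0 pK] ->]; apply: big_ind => // w _.
by have [wK|wK] := boolP (w \in par K); [apply/QZ/QT|rewrite pK // scale0r].
Qed.

Lemma cone1 K : cone K 1.
Proof. by rewrite -basis_elt1; apply: cone_basis; exact: group1. Qed.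

Lemma cone_T K i : i \in K -> cone K (T i).
Proof. by move=> iK; rewrite -basis_elt_simple; apply/cone_basis/simple_par. Qed.

Lemma cone_mulT K i a : i \in K -> cone K a -> cone K (a * T i).
Proof.
move=> iK; move: a; apply: cone_ind => [|a b ha hb|c a c0 ha|w wK].
- by rewrite mul0r; exact: cone0.
- by rewrite mulrDl; exact: coneD.
- by rewrite -scalerAl; exact: coneZ.
have wK' : (w * simple i)%g \in par K by rewrite groupM ?simple_par.
have [h|h] := boolP (asc i w^-1%g); first by rewrite basis_T_asc //; apply: cone_basis.
rewrite basis_T_desc //; apply: coneD; first exact: cone_basis.
by apply: coneZ; [exact: nnegX | exact: cone_basis].
Qed.

(** Induction along reduced words, one generator on the right at a time; it reduces statements about
    products to [cone_mulT]. *)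
Lemma cone_ind_word K (Q : H -> Prop) :
  Q 0 -> (forall a b, Q a -> Q b -> Q (a + b)) ->
  (forall c a, nneg c -> Q a -> Q (c *: a)) ->
  Q 1 -> (forall a i, i \in K -> cone K a -> Q a -> Q (a * T i)) ->
  forall h, cone K h -> Q h.
Proof.
move=> Q0 QD QZ Q1 QT; apply: cone_ind => // w /par_reduced_word[r [rK <- rs]].
rewrite basis_elt_word // {rs}.
suff: cone K (word_elt r) /\ Q (word_elt r) by case.
elim/last_ind: r rK => [|r i IH] rK.
  by rewrite word_elt_nil; split=> //; exact: cone1.
have iK : i \in K by apply: rK; rewrite mem_rcons inE eqxx.
have [|h1 h2] := IH.
  by move=> j jr; apply: rK; rewrite mem_rcons inE jr orbT.
by rewrite -cats1 word_elt_cat word_elt1; split; [apply: cone_mulT | apply: QT].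
Qed.

Lemma coneM K a b : cone K a -> cone K b -> cone K (a * b).
Proof.
move=> ha; move: b; apply: cone_ind_word => [|b c hb hc|c b c0 hb||b i iK hb hab].
- by rewrite mulr0; exact: cone0.
- by rewrite mulrDr; exact: coneD.
- by rewrite -scalerAr; exact: coneZ.
- by rewrite mulr1.
- by rewrite mulrA; exact: cone_mulT.
Qed.

Lemma coneS J K h : J \subset K -> cone J h -> cone K h.
Proof.
move=> JK [p [p0 pJ] ->]; exists p => //; split=> // w wK; apply: pJ.
by apply: contra wK; apply/subsetP/parS.
Qed.

Lemma cone_word K r : {subset r <= K} -> cone K (word_elt r).
Proof.
elim: r => [|i r IH] rK; first by rewrite word_elt_nil; exact: cone1.
rewrite word_elt_cons; apply: coneM; first by apply/cone_T/rK; rewrite inE eqxx.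
by apply: IH => j jr; apply: rK; rewrite inE jr orbT.
Qed.

Lemma comm_cone K h a : (forall i, i \in K -> T i * h = h * T i) -> cone K a ->
  a * h = h * a.
Proof.
move=> hK; move: a; apply: cone_ind_word => [|a b ha hb|c a c0 ha||a i iK _ ha].
- by rewrite mulr0 mul0r.
- by rewrite mulrDr mulrDl ha hb.
- by rewrite -scalerAr -scalerAl ha.
- by rewrite mulr1 mul1r.
- by rewrite -mulrA hK // mulrA ha mulrA.
Qed.

Definition below K (k : nat) := [set i in K | (i < k)%N].

Lemma below_sub K k : below K k \subset K.
Proof. by apply/subsetP=> i; rewrite inE => /andP[]. Qed.

Lemma belowS K k l : (k <= l)%N -> below K k \subset below K l.
Proof.
by move=> kl; apply/subsetP=> i; rewrite !inE => /andP[-> ik]; apply: leq_trans kl.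
Qed.

Lemma comm_below K i k a : (k < i)%N -> cone (below K k) a -> a * T i = T i * a.
Proof.
move=> ki; apply: comm_cone => j; rewrite inE => /andP[_ jk].
by apply: T_far; lia.
Qed.

Lemma belowP K (k : nat) :
  (exists2 i : 'I_n.-1, i = k :> nat & i \in K) \/ below K k.+1 = below K k.
Proof.
have [i /andP[iK /eqP ik]|h] := pickP [pred i : 'I_n.-1 | (i \in K) && (i == k :> nat)].
  by left; exists i.
right; apply/setP=> i; rewrite !inE ltnS leq_eqVlt.
by have /= := h i; case: (i \in K) => //= ->.
Qed.

(** Expressing the span of H_i and H_i T_i H_i through predicates makes the decomposition an
    induction principle, in which [Q] can be replaced by its pullback along a multiplication. *)
Definition split_closed K i (Q : H -> Prop) :=
  [/\ Q 0, (forall a b, Q a -> Q b -> Q (a + b)),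
     (forall c a, nneg c -> Q a -> Q (c *: a)),
     (forall a, cone (below K i) a -> Q a) &
     (forall a b, cone (below K i) a -> cone (below K i) b -> Q (a * T i * b))].

Lemma cone_split_step K i : i \in K ->
  (forall Q a b, split_closed K i Q -> cone (below K i) a -> cone (below K i) b ->
    Q (a * T i * b * T i)) ->
  forall Q h, split_closed K i Q -> cone (below K i.+1) h -> Q h.
Proof.
move=> iK main Q h QC hK; move: h hK Q QC.
apply: cone_ind_word => [|a b ha hb|c a c0 ha||a j jK _ ha] Q QC.
- by case: QC.
- by case: (QC) => _ QD _ _ _; apply: QD; [apply: ha | apply: hb].
- by case: (QC) => _ _ QZ _ _; apply: QZ => //; apply: ha.
- by case: (QC) => _ _ _ Q1 _; apply/Q1/cone1.
(* The induction hypothesis holds for every closed predicate; it is used for the pullback of [Q]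
   under right multiplication by T_j. *)
case: (QC) => Q0 QD QZ Q1 QT; have /= := ha (fun z => Q (z * T j)); apply; split.
- by rewrite mul0r.
- by move=> u v hu hv; rewrite mulrDl; apply: QD.
- by move=> c u c0 hu; rewrite -scalerAl; apply: QZ.
- move=> u hu; have [->|ji] := eqVneq j i.
    by rewrite -[_ * _]mulr1; apply: QT => //; exact: cone1.
  apply/Q1/cone_mulT => //; move: jK; rewrite !inE => /andP[-> /=].
  by move: ji; rewrite -val_eqE /=; lia.
- move=> u v hu hv; have [->|ji] := eqVneq j i; first exact: main.
  rewrite -mulrA; apply: QT => //; apply/cone_mulT => //; move: jK; rewrite !inE => /andP[-> /=].
  by move: ji; rewrite -val_eqE /=; lia.
Qed.

(* H_{i+1} = H_i + H_i T_i H_i, where H_i is generated by the T_j with j < i. *)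
Lemma cone_split K i (Q : H -> Prop) : i \in K -> split_closed K i Q ->
  forall h, cone (below K i.+1) h -> Q h.
Proof.
move: {2}(val i) (leqnn i) => N; elim: N i Q => [|N IH] i Q iN iK QC h;
  move: h Q QC => h Q QC; apply: cone_split_step QC => // {}Q a b QC ha hb;
  case: (QC) => Q0 QD QZ Q1 QT;
  have comm_case c : c * T i = T i * c -> cone (below K i) c -> Q (a * T i * c * T i).
- move=> e hc; rewrite -mulrA e mulrA -(mulrA a) T_sqr mulrDr mulr1 mulrDl.
  rewrite -scalerAr -scalerAl; apply: QD; first by apply/Q1/coneM.
  by apply: QZ; [exact: nnegX | apply: QT].
- apply: comm_case => //; move: hb; apply: comm_cone => j; rewrite inE; lia.
- move=> e hc; rewrite -mulrA e mulrA -(mulrA a) T_sqr mulrDr mulr1 mulrDl.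
  rewrite -scalerAr -scalerAl; apply: QD; first by apply/Q1/coneM.
  by apply: QZ; [exact: nnegX | apply: QT].
case ei : (nat_of_ord i) iN hb => [|k] iN hb.
  by apply: comm_case; rewrite ?ei //; move: hb; apply: comm_cone => j; rewrite inE; lia.
have [[j jk jK]|e] := belowP K k; last first.
  (* Without the generator i-1 in K, [b] only involves generators commuting with T_i. *)
  apply: comm_case; last by rewrite ei.
  by rewrite e in hb; apply: comm_below hb; rewrite ei.
have sub : below K j \subset below K i by apply: belowS; lia.
(* Now [b] is itself split at T_j with j = i-1. Its part in H_j commutes with T_i, and for u T_j v
   the braid relation gives T_i u T_j v T_i = u T_j T_i T_j v, with a single T_i. *)
rewrite -jk in hb; move: b hb; apply: (IH j (fun b => Q (a * T i * b * T i))) => //; first by lia.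
split.
- by rewrite mulr0 mul0r.
- by move=> u v hu hv; rewrite mulrDr mulrDl; apply: QD.
- by move=> c u c0 hu; rewrite -scalerAr -scalerAl; apply: QZ.
- move=> u hu; apply: comm_case; last exact: coneS hu.
  by apply: comm_below hu; lia.
- move=> u v hu hv; have ij : i = j.+1 :> nat by lia.
  have cu : u * T i = T i * u by apply: comm_below hu; lia.
  have cv : v * T i = T i * v by apply: comm_below hv; lia.
  have jb : j \in below K i by rewrite inE jK /=; lia.
  rewrite (_ : _ * _ = a * u * T j * T i * (T j * v)).
    have su := coneS sub hu; have sv := coneS sub hv.
    by apply: QT; [apply/cone_mulT/coneM | apply/coneM/sv/cone_T].
  rewrite -!mulrA cv [T i * (u * _)]mulrA -cu; congr (a * _); rewrite -!mulrA; congr (u * _).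
  by rewrite !mulrA (T_braid ij).
Qed.

End Hecke.

(** * Increasing enumeration of a set of generators *)

Section Words.
Variable n : nat.
Implicit Types (I K : {set 'I_n.-1}) (i : 'I_n.-1).

Lemma enum_ord_sorted I : sorted (fun i j : 'I_n.-1 => (i < j)%N) (enum I).
Proof.
have : sorted ltn (map val (enum 'I_n.-1)) by rewrite val_enum_ord iota_ltn_sorted.
rewrite sorted_map => h; rewrite enumT in h; rewrite /enum_mem; apply: sorted_filter h.
by move=> a b c /=; apply: ltn_trans.
Qed.

Lemma enum_rcons I i : (forall j, j \in I -> (j < i)%N) ->
  enum (i |: I) = rcons (enum I) i.
Proof.
move=> h; apply: (@irr_sorted_eq _ (fun i j : 'I_n.-1 => (i < j)%N)).
- by move=> a b c /=; apply: ltn_trans.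
- by move=> a /=; rewrite ltnn.
- exact: enum_ord_sorted.
- have := enum_ord_sorted I; case e : (enum I) => [//|a s] /=.
  rewrite rcons_path => ->; apply: h; rewrite -mem_enum e; exact: mem_last.
- by move=> j; rewrite mem_rcons inE !mem_enum !inE.
Qed.

End Words.

(** * The symmetrizing trace *)

Section Trace.

Variables (n : nat) (H : algType {poly int}) (T : 'I_n.-1 -> H).
Hypothesis relT : hecke_relations T.
Variable tau : H -> {poly int}.
Hypothesis tau_lin : forall (c : {poly int}) (a b : H), tau (c *: a + b) = c * tau a + tau b.
Hypothesis tau_basis : forall w : 'S_n, tau (basis_elt T w) = (w == 1%g)%:R.
Implicit Types (I J K L : {set 'I_n.-1}) (i j : 'I_n.-1) (w d u x y : 'S_n) (r s t : seq 'I_n.-1).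
Implicit Types (a b h : H).

Notation Tw := (basis_elt T).
Notation cone := (cone T).
Notation word_elt := (word_elt T).

Lemma tauD a b : tau (a + b) = tau a + tau b.
Proof. by have := tau_lin 1 a b; rewrite scale1r mul1r. Qed.

Lemma tau0 : tau 0 = 0.
Proof. by apply: (addrI (tau 0)); rewrite -tauD !addr0. Qed.

Lemma tauZ c a : tau (c *: a) = c * tau a.
Proof. by have := tau_lin c a 0; rewrite tau0 !addr0. Qed.

Lemma tauB a b : tau (a - b) = tau a - tau b.
Proof. by rewrite -scaleN1r addrC tau_lin mulN1r addrC. Qed.

Lemma tau_sum (I : Type) (r : seq I) (P : pred I) (F : I -> H) :
  tau (\sum_(i <- r | P i) F i) = \sum_(i <- r | P i) tau (F i).
Proof. by apply: big_morph; [exact: tauD | exact: tau0]. Qed.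

(** The first letter of a reduced word of [y] is moved over to [x], leaving the product of the two
    permutations unchanged. *)
Lemma tau_basisM x y : tau (Tw x * Tw y) = (x * y == 1)%g%:R.
Proof.
have [r <-] := reduced_wordP y; elim: r x => [|i r IH] x rl.
  by rewrite /word_perm big_nil (basis_elt1 relT) mulr1 mulg1.
have di := reduced_desc (esym rl); move: rl; rewrite word_perm_cons in di * => rl.
have ai : asc i (word_perm r) by rewrite -[word_perm r](simple_mulK i) asc_simple.
have lr : size r = perm_length (word_perm r) by move: rl; rewrite length_asc //= => -[].
rewrite -(T_basis_asc relT ai) mulrA.
have [h|h] := boolP (asc i x^-1%g).
  by rewrite (basis_T_asc relT h) IH // mulgA.
rewrite (basis_T_desc relT h) mulrDl -scalerAl tauD tauZ !IH // mulgA.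
(* The extra term from the quadratic relation vanishes: x^-1 has a descent at i, whereas the rest of
   the word ascends there. *)
rewrite [(x * word_perm r == 1)%g](_ : _ = false) ?mulr0 ?addr0 //.
apply/negP=> /eqP e; have e' : (x^-1 = word_perm r)%g by apply/eqP; rewrite eq_invg_mul e.
by rewrite e' ai in h.
Qed.

Lemma tau_nneg h : cone setT h -> nneg (tau h).
Proof.
move: h; apply: cone_ind => [|a b ha hb|c a c0 ha|w _].
- by rewrite tau0 nneg0.
- by rewrite tauD nnegD.
- by rewrite tauZ nnegM.
- by rewrite tau_basis nneg_nat.
Qed.

Lemma tauC a b : cone setT a -> cone setT b -> tau (a * b) = tau (b * a).
Proof.
move=> ha; move: b; apply: cone_ind => [|b c hb hc|c b _ hb|y _].
- by rewrite mulr0 mul0r.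
- by rewrite mulrDr mulrDl !tauD hb hc.
- by rewrite -scalerAr -scalerAl !tauZ hb.
move: a ha; apply: cone_ind => [|b c hb hc|c b _ hb|x _].
- by rewrite mulr0 mul0r.
- by rewrite mulrDr mulrDl !tauD hb hc.
- by rewrite -scalerAr -scalerAl !tauZ hb.
by rewrite !tau_basisM -eq_invg_mul eq_invg_sym eq_sym eq_invg_mul.
Qed.

Lemma coneT K a : cone K a -> cone setT a.
Proof. by apply: coneS; exact: subsetT. Qed.

(** The T_{w^-1} form the dual basis for tau, which makes coefficients unique. *)
Lemma tau_coef (p : 'S_n -> {poly int}) w :
  tau ((\sum_x p x *: Tw x) * Tw w^-1%g) = p w.
Proof.
rewrite mulr_suml tau_sum (bigD1 w) //= -scalerAl tauZ tau_basisM mulgV eqxx mulr1.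
rewrite big1 ?addr0 // => x /negPf xw.
by rewrite -scalerAl tauZ tau_basisM -eq_mulgV1 xw mulr0.
Qed.

Lemma cone_sub K a b : cone K a -> cone K b ->
  (forall w, w \in par K -> nneg (tau ((a - b) * Tw w^-1%g))) -> cone K (a - b).
Proof.
move=> [p [p0 pK] ->] [q [q0 qK] ->] h; exists (fun w => p w - q w).
  split=> w => [|wK]; last by rewrite pK // qK // subr0.
  have [wK|wK] := boolP (w \in par K); last by rewrite pK // qK // subr0 nneg0.
  by have := h _ wK; rewrite mulrBl tauB !tau_coef.
by rewrite -sumrB; apply: eq_bigr => w _; rewrite scalerBl.
Qed.

Lemma cone_add_eq0 K a b : cone K a -> cone K b -> a + b = 0 -> a = 0.
Proof.
move=> [p [p0 pK] ->] [q [q0 qK] ->] e; rewrite big1 // => w _.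
rewrite (@nneg_add_eq0 (p w) (q w)) ?scale0r //.
by rewrite -(tau_coef p w) -(tau_coef q w) -tauD -mulrDl e mul0r tau0.
Qed.

Section Central.

Variables (K : {set 'I_n.-1}) (A B : H).
Hypotheses (hA : cone K A) (hB : cone K B).
Hypotheses (cA : forall i, i \in K -> T i * A = A * T i)
           (cB : forall i, i \in K -> T i * B = B * T i).

(** [A] and [B] are kept apart because the trace property and centrality are applied to elements of
    the cone, and [A - B] is not yet known to be one. *)
Let phi (x : H) := tau ((A - B) * x).

Lemma phiC a b : cone K a -> cone K b -> phi (a * b) = phi (b * a).
Proof.
move=> ha hb; rewrite /phi !mulrBl !tauB.
have st h c : cone K h -> (forall i, i \in K -> T i * h = h * T i) -> c = b ->
    tau (h * (a * c)) = tau (h * (c * a)).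
  move=> hh ch ->; have cb := comm_cone relT ch hb.
  rewrite mulrA tauC ?mulrA ?cb //; last exact: coneT hb.
  by apply/coneT/(coneM relT hh ha).
by rewrite !st.
Qed.

Lemma phiD a b : phi (a + b) = phi a + phi b.
Proof. by rewrite /phi mulrDr tauD. Qed.
Lemma phiZ c a : phi (c *: a) = c * phi a.
Proof. by rewrite /phi -scalerAr tauZ. Qed.

(* phi (a T_k b G) = phi (b a (T_k G)), and b a has one generator less. *)
Lemma trace_nneg k G : cone K G ->
  (forall j, j \in K -> (j.+1 < k)%N -> T j * G = G * T j) ->
  (forall I, I \subset below K k -> nneg (phi (word_elt (enum I) * G))) ->
  forall a, cone (below K k) a -> nneg (phi (a * G)).
Proof.
elim: k G => [|k IH] G hG cG h.
  have b0 : below K 0 = set0 by apply/setP=> i; rewrite !inE ltn0 andbF.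
  rewrite b0; apply: cone_ind => [|a b ha hb|c a c0 ha|w].
  - by rewrite mul0r /phi mulr0 tau0 nneg0.
  - by rewrite mulrDl phiD nnegD.
  - by rewrite -scalerAl phiZ nnegM.
  rewrite /par /= par0 inE => /eqP->; rewrite (basis_elt1 relT).
  by have := h set0; rewrite enum_set0 word_elt_nil b0 => /(_ (subxx _)).
have IHG a : cone (below K k) a -> nneg (phi (a * G)).
  apply: IH => // [j jK jk|I Ik]; first by apply: cG => //; lia.
  by apply: h; apply: subset_trans Ik _; apply: belowS.
have [[i ik iK]|->] := belowP K k; last exact: IHG.
rewrite -ik; apply: (cone_split relT iK); split.
- by rewrite mul0r /phi mulr0 tau0 nneg0.
- by move=> a b ha hb; rewrite mulrDl phiD nnegD.
- by move=> c a c0 ha; rewrite -scalerAl phiZ nnegM.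
- by rewrite ik.
move=> a b; rewrite ik => ha hb.
(* [G] collects the generators already moved to the end. It commutes with all generators below i, so
   [b] passes it; for the next [T i * G] the range shrinks by one, as T_j commutes with T_i only
   when j+1 < i. *)
have hbG : b * G = G * b.
  move: hb; apply: comm_cone => // j; rewrite inE => /andP[jK jk]; exact: cG.
have haK := coneS (below_sub K k) ha; have hbK := coneS (below_sub K k) hb.
have hTG : cone K (T i * G) by apply: (coneM relT) => //; apply: (cone_T relT).
rewrite -!mulrA hbG mulrA mulrA phiC //; last first.
  by rewrite -mulrA; apply: (coneM relT).
rewrite -mulrA mulrA; apply: IH => //; last exact: (coneM relT).
- move=> j jK jk; rewrite mulrA T_far //; last lia.
  by rewrite -!mulrA cG //; lia.
- move=> I Ik; rewrite mulrA -(word_elt1 T) -word_elt_cat cats1.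
  have sub : i |: I \subset below K k.+1.
    rewrite subUset sub1set inE iK ik ltnSn /=; apply: subset_trans Ik _.
    exact: belowS.
  rewrite -enum_rcons; first exact: h.
  by move=> j /(subsetP Ik); rewrite inE ik => /andP[].
Qed.

(** Rotating around its largest letter i turns s1 i s2 into s2 s1 i, so the value of a word without
    repetition depends only on its set of letters. [G] again holds the letters already moved. *)
Lemma trace_word k G s : cone K G ->
  (forall j, j \in K -> (j.+1 < k)%N -> T j * G = G * T j) ->
  uniq s -> {subset s <= below K k} ->
  phi (word_elt s * G) = phi (word_elt (enum [set i in s]) * G).
Proof.
elim: k G s => [|k IH] G s hG cG us sk.
  case: s us sk => [|i s] _ sk; last by have := sk i; rewrite !inE eqxx ltn0 andbF => /(_ isT).
  by rewrite (_ : [set i in [::]] = set0) ?enum_set0 //; apply/setP=> i; rewrite !inE.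
have [/hasP[i si /eqP ik]|/hasPn nk] := boolP (has (fun i : 'I_n.-1 => i == k :> nat) s); last first.
  apply: IH => // [j jK jk|i si]; first by apply: cG => //; lia.
  by have := sk _ si; have := nk _ si; rewrite !inE => ? /andP[-> /=]; lia.
have iK : i \in K by have := sk _ si; rewrite inE => /andP[].
case/splitPr: s / si us sk => s1 s2 us sk.
have ss j : j \in s2 ++ s1 -> j \in below K k.
  rewrite mem_cat => js; have : j \in below K k.+1.
    by apply: sk; rewrite mem_cat inE; case/orP: js => ->; rewrite ?orbT.
  rewrite !inE => /andP[-> /=]; rewrite ltnS leq_eqVlt -ik => /orP[/eqP/val_inj e|//].
  by move: us; rewrite uniq_catC /= -e => /andP[]; rewrite mem_cat js.
have hs r : {subset r <= s2 ++ s1} -> cone K (word_elt r).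
  move=> hr; apply: (coneS (below_sub K k)); apply: (cone_word relT) => j /hr; exact: ss.
have h1 : cone K (word_elt s1) by apply: hs => j; rewrite mem_cat orbC => ->.
have h2 : cone K (word_elt s2) by apply: hs => j; rewrite mem_cat => ->.
have h2k : cone (below K k) (word_elt s2).
  by apply: (cone_word relT) => j js; apply: ss; rewrite mem_cat js.
have hTG : cone K (T i * G) by apply: (coneM relT) => //; apply: (cone_T relT).
have c2 : word_elt s2 * G = G * word_elt s2.
  move: h2k; apply: comm_cone => // j; rewrite inE => /andP[jK jk]; exact: cG.
rewrite word_elt_cat word_elt_cons -!mulrA c2 mulrA mulrA phiC //; last first.
  by rewrite -mulrA; apply: (coneM relT).
rewrite -mulrA [word_elt s2 * _]mulrA -word_elt_cat IH //; last 2 first.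
- by move=> j jK jk; rewrite mulrA T_far //; [rewrite -!mulrA cG //|]; lia.
- by move: us; rewrite uniq_catC /= => /andP[].
rewrite mulrA -(word_elt1 T) -word_elt_cat cats1 -enum_rcons; last first.
  by move=> j; rewrite inE => /ss; rewrite inE ik => /andP[].
rewrite (_ : [set j in s1 ++ i :: s2] = i |: [set j in s2 ++ s1]) //.
apply/setP=> j; rewrite !inE !mem_cat inE.
by case: (j == i); case: (j \in s1); case: (j \in s2).
Qed.

Lemma phi_word s : uniq s -> {subset s <= K} ->
  phi (word_elt s) = phi (word_elt (enum [set i in s])).
Proof.
move=> us sK; have := @trace_word n.-1 1 s (cone1 relT K); rewrite !mulr1; apply=> //.
  by move=> j _ _; rewrite mulr1 mul1r.
by move=> i si; rewrite inE sK /=.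
Qed.

Lemma cone_central :
  (forall I, I \subset K -> nneg (phi (word_elt (enum I)))) -> cone K (A - B).
Proof.
move=> h; apply: cone_sub => // w wK; rewrite -[Tw _]mulr1.
apply: (@trace_nneg n.-1 1 (cone1 relT K)).
- by move=> j _ _; rewrite mulr1 mul1r.
- by move=> I IK; rewrite mulr1; apply: h; apply: subset_trans IK (below_sub _ _).
apply: (cone_basis); rewrite groupV (_ : below K n.-1 = K) //.
by apply/setP=> i; rewrite inE ltn_ord andbT.
Qed.

End Central.

End Trace.

(* The regular representation in the basis T_w, in which the row vector
   [regular_vec p] stands for T_w with w = p^-1. *)
Section Regular.

Variable n : nat.
Implicit Types (i j : 'I_n.-1) (p w : 'S_n).

(** A predecessor, so that the matrices have size [_.+1] and form an algebra. *)
Definition regular_dim : nat := #|{: 'S_n}|.-1.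

Fact regular_dimE : #|{: 'S_n}| = regular_dim.+1.
Proof. by rewrite prednK //; apply/card_gt0P; exists 1%g. Qed.

Definition perm_index p : 'I_regular_dim.+1 := cast_ord regular_dimE (enum_rank p).
Definition index_perm (a : 'I_regular_dim.+1) : 'S_n :=
  enum_val (cast_ord (esym regular_dimE) a).

Lemma perm_indexK : cancel perm_index index_perm.
Proof. by move=> p; rewrite /index_perm cast_ordK enum_rankK. Qed.
Lemma index_permK : cancel index_perm perm_index.
Proof. by move=> a; rewrite /perm_index enum_valK cast_ordKV. Qed.

Definition regular_vec p : 'rV[{poly int}]_regular_dim.+1 := delta_mx 0 (perm_index p).
Notation e := regular_vec.

Definition desc_coef (b : bool) : {poly int} := if b then 0 else 'X.

(** Right multiplication by T_i. Row vectors are acted on from the right, and the right descents of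
    w = p^-1 are the left descents of [p] tested by [asc]. *)
Definition regular_gen i : 'M[{poly int}]_regular_dim.+1 :=
  \matrix_a (e (simple i * index_perm a)%g
             + desc_coef (asc i (index_perm a)) *: e (index_perm a)).
Notation U := regular_gen.

Lemma regular_vec_mul i p : e p *m U i = e (simple i * p)%g + desc_coef (asc i p) *: e p.
Proof. by rewrite -rowE rowK perm_indexK. Qed.

Lemma regular_eq (A B : 'M[{poly int}]_regular_dim.+1) :
  (forall p, e p *m A = e p *m B) -> A = B.
Proof.
by move=> h; apply/row_matrixP=> a; have := h (index_perm a); rewrite /e index_permK -!rowE.
Qed.

Lemma regular_relations : hecke_relations U.
Proof.
split=> [i j ij|i j ij|i]; apply: regular_eq => p.
- rewrite -!mulmxE !mulmxA !regular_vec_mul !mulmxDl -!scalemxAl !regular_vec_mul.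
  rewrite !asc_far ?ij ?orbT // !mulgA (simple_comm ij).
  by apply/rowP=> a; rewrite !mxE; ring.
(* All the tests compare values of [p] at three consecutive points. The fact [e4] is transitivity:
   it excludes the two cyclic patterns and leaves the six possible orders. *)
- have [e1 e2 e3 e4] : [/\ asc i (simple j * p)%g = asc j (simple i * p)%g,
      asc i (simple j * (simple i * p))%g = asc j p,
      asc j (simple i * (simple j * p))%g = asc i p &
      asc i p = asc j p -> asc j (simple i * p)%g = asc i p].
    have h : hi i = lo j by apply: val_inj; rewrite /= ij.
    have f1 : simple j (lo i) = lo i by apply: simple_far => /=; lia.
    have f2 : simple i (hi j) = hi j by apply: simple_far => /=; lia.
    have f3 : simple i (lo j) = lo i by rewrite -h simpleE tpermR.
    have f4 : simple j (lo j) = hi j by rewrite simpleE tpermL.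
    have f5 : simple i (lo i) = lo j by rewrite simpleE tpermL.
    have f6 : simple j (hi j) = lo j by rewrite simpleE tpermR.
    rewrite /asc !permM !h !(f1, f2, f3, f4, f5, f6); split=> //.
    have := @perm_inj _ p (lo i) (lo j); have := @perm_inj _ p (lo i) (hi j).
    have n1 : lo i != lo j by rewrite -h -val_eqE /=; lia.
    have n2 : lo i != hi j by rewrite -val_eqE /=; lia.
    move=> i2 i1; have m1 : p (lo i) != p (lo j) by apply: contra n1 => /eqP/i1->.
    have m2 : p (lo i) != p (hi j) by apply: contra n2 => /eqP/i2->.
    by move: m1 m2; rewrite -!val_eqE /=; lia.
  rewrite -!mulmxE !mulmxA.
  rewrite !(regular_vec_mul, mulmxDl, =^~ scalemxAl) !asc_simple !e1 !e2 !e3 !simple_mulK.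
  have eb : (simple i * (simple j * (simple i * p)) = simple j * (simple i * (simple j * p)))%g.
    by rewrite !mulgA (simple_braid ij).
  rewrite eb; move: e4; case: (asc i p); case: (asc j p); case: (asc j _) => /= e4;
    try (by have := e4 erefl); by apply/rowP=> a; rewrite /desc_coef !mxE; ring.
- rewrite -mulmxE mulmxA regular_vec_mul mulmxDr mulmx1 mulmxDl -scalemxAl -scalemxAr.
  rewrite !regular_vec_mul asc_simple simple_mulK.
  by case: (asc i p); apply/rowP=> a; rewrite /desc_coef /= !mxE; ring.
Qed.

End Regular.

(** The universal property maps H to the matrix algebra; tau reads off the coordinate at 1 of the
    image of the vector of 1. An induction stripping right descents of [w] shows that T_w sends this
    vector to that of w^-1. *)
Lemma trace_exists (n : nat) (H : algType {poly int}) (T : 'I_n.-1 -> H) :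
  is_hecke_algebra T -> exists tau : H -> {poly int},
  (forall (c : {poly int}) (a b : H), tau (c *: a + b) = c * tau a + tau b)
  /\ (forall w : 'S_n, tau (basis_elt T w) = (w == 1%g)%:R).
Proof.
move=> [relT univ]; have [f [fT _]] := univ _ _ (@regular_relations n).
pose e := @regular_vec n.
exists (fun h => (e 1%g *m f h) 0 (perm_index 1%g)); split=> [c a b|w].
  by rewrite linearP mulmxDr -scalemxAr !mxE.
suff -> : e 1%g *m f (basis_elt T w) = e w^-1%g.
  rewrite mxE eqxx /= (can_eq (@perm_indexK n)); congr (_%:R).
  by rewrite eq_sym invg_eq1.
move: {2}(perm_length w) (leqnn (perm_length w)) => N.
elim: N w => [|N IH] w wN.
  have /eqP-> : w == 1%g by rewrite -length_eq0 -leqn0.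
  by rewrite (basis_elt1 relT) rmorph1 mulmx1 invg1.
have [h|/existsP[i ni]] := boolP [forall i, asc i w^-1%g].
  have /eqP : w^-1%g = 1%g by apply: all_asc_eq1; apply/forallP.
  by rewrite invg_eq1 => /eqP->; rewrite (basis_elt1 relT) rmorph1 mulmx1 invg1.
pose v := (w * simple i)%g.
have ev : (v^-1 = simple i * w^-1)%g by rewrite invMg simpleV.
have av : asc i v^-1%g by rewrite ev asc_simple.
have -> : w = (v * simple i)%g by rewrite /v -mulgA simpleK mulg1.
rewrite -(basis_T_asc relT av) rmorphM /= -mulmxE mulmxA IH; last first.
  by have := length_desc ni; rewrite -ev !lengthV; lia.
by rewrite fT regular_vec_mul av scale0r addr0 [(v * _)^-1%g]invMg simpleV.
Qed.

(** * Coset representatives and right multiplication *)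

Section Reps.
Variable n : nat.
Local Open Scope group_scope.
Implicit Types (J K L : {set 'I_n.-1}) (i j l : 'I_n.-1) (w d u x y : 'S_n).

Lemma asc_notin K i w : i \notin K -> w \in par K -> asc i w.
Proof.
move=> iK /parP wK; rewrite /asc ltnNge; apply/negP=> /(blk_mono K).
by rewrite !wK /= blkS iK; lia.
Qed.

Lemma conj_simple i j d : d (lo j) = lo i -> d (hi j) = hi i ->
  simple j * d = d * simple i.
Proof. by move=> h1 h2; rewrite [simple i]simpleE -h1 -h2 -tpermJ conjgE mulgA mulgA mulgV mul1g. Qed.

(** Deodhar's alternative: right multiplication by s_i only changes the comparison of the values i
    and i+1, so a new descent j in J means that [d] sends j, j+1 to i, i+1. *)
Lemma reps_mulr J K i d : i \in K -> d \in min_coset_reps (par K) (par J) ->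
  d * simple i \notin min_coset_reps (par K) (par J) ->
  exists2 j, j \in J & simple j * d = d * simple i.
Proof.
move=> iK /mem_reps[dK dJ] h.
have [/forall_inP a|] := boolP [forall j in J, asc j (d * simple i)].
  by case/negP: h; apply/mem_reps; split; rewrite // groupM ?simple_par.
rewrite negb_forall_in => /exists_inP[j jJ na]; exists j => //.
have := dJ _ jJ; move: na; rewrite ascN /asc !permM !simple_val => na aj.
by apply: conj_simple; apply: val_inj => /=; move: na aj; do !case: eqP => //; lia.
Qed.

Lemma reps_self K : min_coset_reps (par K) (par K) = 1.
Proof.
apply/setP=> d; apply/idP/set1gP => [/mem_reps[dK da]|->]; last exact: one_reps.
have [] // := @reps_unique n K d 1 1 d dK (group1 _) _ da; last by rewrite mulg1 mul1g.
by move=> i _; rewrite /asc !perm1 /=.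
Qed.

(* The cosets of a maximal parabolic subgroup: the nontrivial representatives are
   s_j, s_j s_(j-1), s_j s_(j-1) s_(j-2), ... *)
Lemma reps_top L j d : (forall l, l \in L -> (l < j)%N) ->
  let L0 := below L j.-1 in
  d \in min_coset_reps (par (j |: L)) (par L) <->
  d = 1 \/ exists2 d', d' \in min_coset_reps (par L) (par L0) & d = simple j * d'.
Proof.
move=> Lj L0; set L' := j |: L.
have jL : j \notin L by apply/negP=> /Lj; rewrite ltnn.
have jL' : j \in L' by rewrite !inE eqxx.
have LL' : L \subset L' by apply: subsetUr.
(* Adding j merges the two blocks meeting there, which lowers by one every block number beyond j. *)
have blkE (y : nat) : blk L y = (blk L' y + (j < y))%N.
  rewrite /blk (_ : [set i | (i \notin L) && (i < y)%N] =
    [set i | (i \notin L') && (i < y)%N] :|: [set i : 'I_n.-1 | (i == j) && (i < y)%N]).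
    rewrite cardsU (_ : _ :&: _ = set0) ?cards0 ?subn0; last first.
      by apply/setP=> i; rewrite !inE; case: eqP => //= _; rewrite andbF.
    congr addn; have [jy|yj] := boolP (j < y)%N.
      rewrite (_ : [set i | _] = [set j]) ?cards1 //.
      by apply/setP=> i; rewrite !inE; case: eqP => // ->.
    apply/eqP; rewrite cards_eq0; apply/eqP/setP=> i; rewrite !inE.
    by case: eqP => // ->; apply/negbTE.
  apply/setP=> i; rewrite !inE negb_or; case: eqP => [->|] /=; first by rewrite jL.
  by rewrite orbF.
(* As j is the largest generator of [L'], its block ends at [hi j]. *)
have top (y : 'I_n) : (blk L' y <= blk L' j)%N -> (y <= hi j)%N.
  move=> h; rewrite leqNgt; apply/negP=> /= jy; have yn := ltn_ord y.
  have j1n : (j.+1 < n.-1)%N by lia.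
  have := blkS L' (Ordinal j1n); have -> : Ordinal j1n \notin L'.
    by apply/negP; rewrite !inE => /orP[/eqP/(congr1 val)/=|/Lj /=]; lia.
  by have := blk_mono L' jy; have /= := blkS L' j; rewrite jL' /=; lia.
have bhj : blk L' j.+1 = blk L' j by rewrite blkS jL'.
split=> [/mem_reps[dL' dL]|[->|[d' /mem_reps[d'L d'0] ->]]]; last 2 first.
- exact: one_reps.
- apply/mem_reps; split.
    by rewrite groupM ?simple_par // (subsetP (parS LL')).
  move=> l lL; have lj := Lj _ lL; have [lj'|lj'] := ltnP l.+1 j.
    by rewrite asc_far ?lj' ?orbT //; apply: d'0; rewrite inE lL /=; lia.
  have e : hi l = lo j by apply: val_inj => /=; lia.
  rewrite /asc !permM e simpleE tpermL tpermD; last 2 first.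
  + by rewrite -e -val_eqE /=; lia.
  + by rewrite -val_eqE /=; lia.
  rewrite ltnNge; apply/negP=> /(blk_mono L); rewrite !(elimT (parP _ _) d'L) /=.
  have := blkS L j; rewrite jL.
  by have := blk_mono L (ltnW lj); lia.
have [/forallP/all_asc_eq1|] := boolP [forall i, asc i d]; first by left.
rewrite negb_forall => /existsP[i ni]; right.
have ij : i = j.
  apply/eqP; apply: contraNT ni => nij.
  have [iL|iL] := boolP (i \in L); first exact: dL.
  by apply: (@asc_notin L') => //; rewrite !inE negb_or nij.
rewrite {i}ij in ni; exists (simple j * d); last by rewrite simple_mulK.
have sL' : simple j * d \in par L' by rewrite groupM ?simple_par.
move/parP: (dL') => dB; move/parP: (sL') => sB.
(* The preimage of the top point [hi j] must end its block of L, since [d] increases there: it is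
   [lo j] or [hi j], and the descent at j rules out the latter. Then s_j d fixes [hi j] and so lies
   in [par L]. *)
have dh : d (lo j) = hi j.
  pose x := d^-1 (hi j); have dx : d x = hi j by rewrite permKV.
  have dlo : (d (lo j) <= hi j)%N by apply: top; rewrite dB.
  have xh : (x <= hi j)%N by apply: top; rewrite -dB dx /= bhj.
  have [xe|xe] := eqVneq x (hi j).
    by move: ni; rewrite ascN -xe dx; lia.
  have [xl|xl] := eqVneq x (lo j); first by rewrite -xl.
  have xlt : (x < lo j)%N by move: xe xl xh; rewrite -!val_eqE /=; lia.
  have := asc_blk dL xlt; rewrite dx.
  suff -> : blk L x = blk L (lo j) by move=> /(_ erefl); lia.
  rewrite !blkE ltnn; have := dB x; rewrite dx /= bhj => <-.
  by move: xlt => /=; case: ltnP => //; lia.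
have sh : (simple j * d) (hi j) = hi j by rewrite permM simpleE tpermR.
apply/mem_reps; split; last first.
  move=> l; rewrite inE => /andP[lL lj]; rewrite asc_far; first exact: dL.
  by apply/orP; right; lia.
apply/parP=> y; rewrite !blkE sB; congr addn; congr nat_of_bool.
set z := (simple j * d) y; have zB : blk L' z = blk L' y by exact: sB.
have [ye|ye] := eqVneq y (hi j); first by rewrite /z ye sh.
have ze : z != hi j by apply: contra ye => /eqP; rewrite /z -{1}sh => /perm_inj/eqP.
have hz := top z; have hy := top y; rewrite zB in hz.
move: ye ze; rewrite -!val_eqE /= => ye ze.
have [jy|yj] := ltnP j y.
  have nhy : ~~ (blk L' y <= blk L' j)%N by apply/negP=> /hy /=; lia.
  rewrite ltnNge; apply/negP=> /(blk_mono L'); lia.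
by have := blk_mono L' yj; move=> /hz /=; lia.
Qed.

End Reps.

(** * Relative norms *)

Section Norm.

Variables (n : nat) (H : algType {poly int}) (T : 'I_n.-1 -> H).
Hypothesis relT : hecke_relations T.
Implicit Types (I J K L : {set 'I_n.-1}) (i j l : 'I_n.-1) (w d u x y : 'S_n) (r s t : seq 'I_n.-1).
Implicit Types (a b h : H).

Notation Tw := (basis_elt T).
Notation cone := (cone T).
Notation word_elt := (word_elt T).
Notation norm K J := (rel_norm T (par K) (par J)).

Lemma basis_eltMV x y : perm_length (x * y)%g = (perm_length x + perm_length y)%N ->
  Tw (x * y)^-1%g = Tw y^-1%g * Tw x^-1%g.
Proof.
move=> e; rewrite invMg (basis_eltM relT) //.
by rewrite -invMg !lengthV e addnC.
Qed.

(** Representatives factor uniquely as e d with additive lengths, so T_{ed} = T_e T_d and the double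
    sum is the single one. *)
Lemma rel_norm_trans J K L h : J \subset K -> K \subset L ->
  norm L J h = norm L K (norm K J h).
Proof.
move=> JK KL; rewrite /rel_norm.
transitivity (\sum_(d in min_coset_reps (par L) (par K))
  \sum_(e in min_coset_reps (par K) (par J)) Tw (e * d)^-1%g * h * Tw (e * d)%g); last first.
  apply: eq_bigr => d /mem_reps[dL dK]; rewrite mulr_sumr mulr_suml.
  apply: eq_bigr => e /mem_reps[eK eJ].
  have le := length_mul_reps eK dK.
  by rewrite basis_eltMV // (basis_eltM relT) // !mulrA.
rewrite pair_big /=.
pose F (p : 'S_n * 'S_n) := (p.2 * p.1)%g.
have -> : min_coset_reps (par L) (par J) =
    F @: (setX (min_coset_reps (par L) (par K)) (min_coset_reps (par K) (par J))).
  apply/setP=> x; apply/idP/imsetP => [/(reps_split JK KL)[e [d [he hd ->]]]|[[d e]]].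
    by exists (d, e); rewrite // in_setX hd.
  by rewrite in_setX => /andP[hd he] ->; apply: reps_mul he hd.
rewrite big_imset; first by apply: eq_bigl => -[d e]; rewrite in_setX.
move=> [d1 e1] [d2 e2]; rewrite !in_setX /= => /andP[/mem_reps[_ h1] /mem_reps[k1 _]].
move=> /andP[/mem_reps[_ h2] /mem_reps[k2 _]] e.
by have [-> ->] := reps_unique k1 k2 h1 h2 e.
Qed.

Lemma rel_norm_cone J K L h : K \subset L -> cone L h -> cone L (norm K J h).
Proof.
move=> KL hh; apply: cone_sum => d /mem_reps[dK _].
by apply: (coneM relT); [apply: (coneM relT) => //|]; apply: cone_basis;
  rewrite ?groupV (subsetP (parS KL)).
Qed.

Lemma rel_normB (G G' : {set 'S_n}) a b :
  rel_norm T G G' (a - b) = rel_norm T G G' a - rel_norm T G G' b.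
Proof. by rewrite /rel_norm -sumrB; apply: eq_bigr => d _; rewrite mulrBr mulrBl. Qed.

Lemma rel_normZ (G G' : {set 'S_n}) c a :
  rel_norm T G G' (c *: a) = c *: rel_norm T G G' a.
Proof.
by rewrite /rel_norm scaler_sumr; apply: eq_bigr => d _; rewrite -scalerAr -scalerAl.
Qed.

Lemma rel_norm_term J K L h d : K \subset L -> cone L h ->
  d \in min_coset_reps (par K) (par J) ->
  cone L (norm K J h - Tw d^-1%g * h * Tw d).
Proof.
move=> KL hh hd; rewrite /rel_norm (bigD1 d) //= addrC addrK.
apply: cone_sum => x /andP[/mem_reps[dK _] _].
by apply: (coneM relT); [apply: (coneM relT) => //|]; apply: cone_basis;
  rewrite ?groupV (subsetP (parS KL)).
Qed.

Lemma rel_norm_ge J K L h : K \subset L -> cone L h -> cone L (norm K J h - h).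
Proof.
move=> KL hh; have := rel_norm_term KL hh (one_reps J K).
by rewrite invg1 (basis_elt1 relT) mul1r mulr1.
Qed.

Lemma rel_norm_self K h : norm K K h = h.
Proof.
by rewrite /rel_norm reps_self big_set1 invg1 (basis_elt1 relT) mul1r mulr1.
Qed.

Lemma rel_norm_mull J K a b : (forall i, i \in K -> T i * a = a * T i) ->
  norm K J (a * b) = a * norm K J b.
Proof.
move=> aK; rewrite /rel_norm mulr_sumr; apply: eq_bigr => d /mem_reps[dK _].
have -> : Tw d^-1%g * (a * b) = a * (Tw d^-1%g * b); last by rewrite !mulrA.
have := comm_cone relT aK (cone_basis T (_ : d^-1%g \in par K)).
by rewrite groupV => /(_ dK) e; rewrite mulrA e mulrA.
Qed.

Lemma rel_norm_mulr J K a b : (forall i, i \in K -> T i * b = b * T i) ->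
  norm K J (a * b) = norm K J a * b.
Proof.
move=> bK; rewrite /rel_norm mulr_suml; apply: eq_bigr => d /mem_reps[dK _].
have e := comm_cone relT bK (cone_basis T dK).
by rewrite -!mulrA e.
Qed.

Lemma basis_conj i j d : asc j d -> (simple j * d = d * simple i)%g ->
  T j * Tw d = Tw d * T i /\ Tw d^-1%g * T j = T i * Tw d^-1%g.
Proof.
move=> aj e; have eV : (simple i * d^-1 = d^-1 * simple j)%g.
  by rewrite -[simple i]simpleV -invMg -e invMg simpleV.
have ai : asc i d^-1%g.
  apply/negPn/negP=> /length_desc; rewrite eV.
  have := lengthV (d^-1 * simple j)%g; rewrite invMg invgK simpleV length_asc //.
  by rewrite lengthV; lia.
rewrite (T_basis_asc relT aj) (basis_T_asc relT ai) e.
by rewrite (T_basis_asc relT ai) eV (basis_T_asc relT) // invgK.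
Qed.

(* The terms of d and d s_i cancel in the commutator when both are representatives;
   otherwise d s_i = s_j d with j in J. *)
Lemma rel_norm_comm J K h : (forall j, j \in J -> T j * h = h * T j) ->
  forall i, i \in K -> T i * norm K J h = norm K J h * T i.
Proof.
move=> hJ i iK; apply/eqP; rewrite -subr_eq0 /rel_norm mulr_sumr mulr_suml -sumrB.
set X := min_coset_reps _ _.
pose y d := Tw d^-1%g * h * Tw d; pose F d := T i * y d - y d * T i.
rewrite (eq_bigr F) // (bigID (fun d => (d * simple i)%g \in X)) /=.
rewrite addrC big1 ?add0r; last first.
  move=> d /andP[dX /(reps_mulr iK dX)[j jJ e]].
  have [_ dJ] := (mem_reps J K d).1 dX.
  have [e1 e2] := basis_conj (dJ _ jJ) e.
  by rewrite /F /y !mulrA -e2 -[_ * T j * h]mulrA hJ // -!mulrA e1 subrr.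
rewrite (bigID (fun d => asc i d^-1%g)) /= addrC.
rewrite (reindex_inj (mulIg (simple i))) /=.
rewrite [X in X + _ == _](eq_bigl (fun d => (d \in X) && ((d * simple i)%g \in X) && asc i d^-1%g)); last first.
  move=> d;  rewrite -mulgA simpleK mulg1 invMg simpleV asc_simple negbK.
  by congr andb; rewrite andbC.
rewrite -big_split big1 //= => d /andP[_ ai].
have e1 : Tw (d * simple i)%g = Tw d * T i by rewrite (basis_T_asc relT).
have e2 : Tw (d * simple i)^-1%g = T i * Tw d^-1%g.
  by rewrite invMg simpleV (T_basis_asc relT).
(* With z = y d the pair contributes z + T_i z T_i; multiplying by T_i on either side gives T_i z +
   z T_i + xi T_i z T_i. *)
rewrite /F; have -> : y (d * simple i)%g = T i * y d * T i by rewrite /y e1 e2 !mulrA.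
move: (y d) => z; rewrite [T i * (_ * _)]mulrA [T i * (T i * _)]mulrA (T_sqr relT).
rewrite -[T i * z * T i * T i]mulrA (T_sqr relT).
rewrite mulrDr mulrDl mulrDl mul1r mulr1 -!scalerAl -!scalerAr -!mulrA.
by rewrite opprD [X in X + _ = _]addrACA subrr addr0 addrA subrK subrr.
Qed.

(** If the inner product is 1 + x, the outer one is T_i (1 + x) T_i = 1 + xi T_i + T_i x T_i. *)
Lemma word_rev_ge1 K s : {subset s <= K} ->
  cone K (word_elt s * word_elt (rev s) - 1).
Proof.
elim: s => [|i s IH] sK.
  by rewrite /rev /= word_elt_nil mulr1 subrr; exact: cone0.
have iK : i \in K by apply: sK; rewrite inE eqxx.
have {}IH := IH (fun j js => sK j (mem_behead (s := i :: s) js)).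
rewrite rev_cons -cats1 word_elt_cons word_elt_cat word_elt1 -!mulrA.
rewrite [word_elt s * _]mulrA -(subrK 1 (_ * word_elt (rev s))).
rewrite mulrDl mul1r mulrDr (T_sqr relT) addrA addrAC addrK.
apply: coneD; last by apply: coneZ; [exact: nnegX | exact: (cone_T relT)].
by apply: (coneM relT); [exact: (cone_T relT) | apply: (cone_mulT relT)].
Qed.

Lemma basis_inv_ge1 K w : w \in par K -> cone K (Tw w^-1%g * Tw w - 1).
Proof.
move=> /par_reduced_word[r [rK <- lr]].
rewrite -word_perm_rev !(basis_elt_word relT) //; last first.
  by rewrite word_perm_rev lengthV size_rev.
rewrite -{2}(revK r); apply: word_rev_ge1 => i; rewrite mem_rev; exact: rK.
Qed.

End Norm.

(** * The elements eta and Jucys-Murphy elements *)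

Section Eta.

Variables (n : nat) (H : algType {poly int}) (T : 'I_n.-1 -> H).
Hypothesis relT : hecke_relations T.
Implicit Types (I J K L : {set 'I_n.-1}) (i j l : 'I_n.-1) (w d u x y : 'S_n) (r s t : seq 'I_n.-1).
Implicit Types (a b h : H).

Notation Tw := (basis_elt T).
Notation cone := (cone T).
Notation word_elt := (word_elt T).
Notation norm K J := (rel_norm T (par K) (par J)).

Lemma below_cons K i : i \in K -> below K i.+1 = i |: below K i.
Proof.
move=> iK; apply/setP=> j; rewrite !inE ltnS leq_eqVlt val_eqE.
by case: eqP => [->|]; rewrite ?iK.
Qed.

Lemma below_lt K k j : j \in below K k -> (j < k)%N.
Proof. by rewrite inE => /andP[]. Qed.

Lemma enum_below K i : i \in K -> enum (below K i.+1) = rcons (enum (below K i)) i.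
Proof. by move=> iK; rewrite below_cons // enum_rcons // => j /below_lt. Qed.

Lemma below_all K : below K n.-1 = K.
Proof. by apply/setP=> i; rewrite inE ltn_ord andbT. Qed.

Lemma below_max (K : {set 'I_n.-1}) (Q : {set 'I_n.-1} -> Prop) :
  Q set0 -> (forall i, i \in K -> Q (below K i) -> Q (below K i.+1)) -> Q K.
Proof.
move=> Q0 QS; suff h k : Q (below K k) by rewrite -(below_all K).
elim: k => [|k IH].
  by rewrite (_ : below K 0 = set0) //; apply/setP=> i; rewrite !inE ltn0 andbF.
by have [[i ik iK]|->//] := belowP K k; rewrite -ik; apply: QS; rewrite ?ik.
Qed.

Lemma word_enum_par I : word_perm (enum I) \in par I.
Proof. by apply: word_par => i; rewrite mem_enum. Qed.

Lemma length_enum I : perm_length (word_perm (enum I)) = #|I|.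
Proof.
apply: (@below_max I (fun K => perm_length (word_perm (enum K)) = #|K|)) => [|i iI IH].
  by rewrite enum_set0 cards0 /word_perm big_nil length1.
rewrite enum_below // -cats1 word_perm_cat -lengthV invMg [word_perm [:: i]]big_seq1 simpleV.
have ni : i \notin below I i by rewrite inE ltnn andbF.
rewrite length_asc; last by apply: asc_notin ni _; rewrite groupV word_enum_par.
by rewrite lengthV IH below_cons // cardsU1 ni.
Qed.

Lemma basis_enum I : Tw (word_perm (enum I)) = word_elt (enum I).
Proof. by rewrite basis_elt_word // length_enum cardE. Qed.

(* If K is the set of generators of S_lambda, this is that of S_(lambda - 1). *)
Definition pred_set K : {set 'I_n.-1} :=
  [set j in K | [exists i in K, i == j.+1 :> nat]].

Definition eta_elt K : H := rel_norm T (par (pred_set K)) 1%g (Tw (word_perm (enum K))).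

(* A multiplicative Jucys-Murphy element: the sum of the T_t over the reflections
   t = (p i+1) with p in the block of i. *)
Definition jucys_murphy K i : H :=
  norm (pred_set (below K i.+1)) (pred_set (below K i)) (T i).
Notation M := jucys_murphy.

Lemma pred_sub K : pred_set K \subset K.
Proof. by apply/subsetP=> i; rewrite inE => /andP[]. Qed.

Lemma pred_belowS K k : pred_set (below K k) \subset pred_set (below K k.+1).
Proof.
apply/subsetP=> i; rewrite !inE => /andP[/andP[-> ik] /exists_inP[j]].
rewrite inE => /andP[jK jk] e; rewrite ltnS ltnW //=.
by apply/exists_inP; exists j; rewrite // inE jK ltnS ltnW.
Qed.

Lemma pred_below_lt K k l : l \in pred_set (below K k) -> l \in K /\ (l.+1 < k)%N.
Proof.
rewrite !inE => /andP[/andP[lK _] /exists_inP[j]].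
by rewrite inE => /andP[_ jk] /eqP <-.
Qed.

Lemma pred_below_sub K k : pred_set (below K k.+1) \subset below K k.
Proof. by apply/subsetP=> l /pred_below_lt[lK lk]; rewrite inE lK. Qed.

Lemma pred_belowE K i j : i \in K -> j \in K -> i = j.+1 :> nat ->
  pred_set (below K i.+1) = j |: pred_set (below K i).
Proof.
move=> iK jK ij; apply/setP=> l; apply/idP/setU1P => [lP|[->|]]; last first.
- by apply: (subsetP (pred_belowS _ _)).
- rewrite !inE jK /=; apply/andP; split; first by lia.
  by apply/exists_inP; exists i; rewrite ?inE ?iK ?ij //=.
have [lK li] := pred_below_lt lP.
have [->|nlj] := eqVneq l j; [by left | right].
have lj : (l.+1 < i)%N by move: nlj li; rewrite -val_eqE ij /=; lia.
rewrite !inE lK /= (ltnW lj) /=; move: lP; rewrite !inE => /andP[_ /exists_inP[m]].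
rewrite inE => /andP[mK _] /eqP ml; apply/exists_inP; exists m; rewrite ?ml //.
by rewrite inE mK ml.
Qed.

Lemma pred_below_iso K i : i \in K -> (forall j, j \in K -> i <> j.+1 :> nat) ->
  pred_set (below K i.+1) = pred_set (below K i).
Proof.
move=> iK hi; apply/eqP; rewrite eqEsubset pred_belowS andbT; apply/subsetP=> l lP.
have [lK li] := pred_below_lt lP.
have lj : (l.+1 < i)%N by have := hi _ lK; lia.
rewrite !inE lK /= (ltnW lj) /=; move: lP; rewrite !inE => /andP[_ /exists_inP[m]].
rewrite inE => /andP[mK _] /eqP ml; apply/exists_inP; exists m; rewrite ?ml //.
by rewrite inE mK ml.
Qed.

(** This matches the subgroup occurring in [reps_top] with the one in the definition of the previous
    Jucys-Murphy element. *)
Lemma pred_below_below K i j : i = j.+1 :> nat ->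
  below (pred_set (below K i)) j.-1 = pred_set (below K j).
Proof.
move=> ij; apply/setP=> l; apply/idP/idP=> [|lP].
  rewrite inE => /andP[lP lj]; have [lK _] := pred_below_lt lP.
  move: lP; rewrite !inE lK /= => /andP[_ /exists_inP[m]].
  rewrite inE => /andP[mK _] ml; apply/andP; split; first by lia.
  by apply/exists_inP; exists m; rewrite // inE mK (eqP ml) /=; lia.
have [lK lj] := pred_below_lt lP; rewrite inE ij (subsetP (pred_belowS _ _) _ lP) /=; lia.
Qed.

Lemma jm_iso K i : i \in K -> (forall j, j \in K -> i <> j.+1 :> nat) -> M K i = T i.
Proof. by move=> iK hi; rewrite /M pred_below_iso // (rel_norm_self relT). Qed.

Lemma far_pred K i j l : i = j.+1 :> nat -> l \in pred_set (below K i) -> T l * T i = T i * T l.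
Proof. by move=> ij /pred_below_lt[_ li]; apply: (T_far relT); rewrite li. Qed.

(** By [reps_top], the representative 1 gives T_i, and s_j d gives T_{d^-1} T_j T_i T_j T_d = T_i
    (T_{d^-1} T_j T_d) T_i, because T_d commutes with T_i. *)
Lemma jm_rec K i j : i \in K -> j \in K -> i = j.+1 :> nat ->
  M K i = T i + T i * M K j * T i.
Proof.
move=> iK jK ij; set L := pred_set (below K i).
have Lj l : l \in L -> (l < j)%N by move=> /pred_below_lt[_]; rewrite ij.
have EL0 : below L j.-1 = pred_set (below K j) by apply: pred_below_below.
have EL : L = pred_set (below K j.+1) by rewrite /L ij.
rewrite /M (pred_belowE iK jK ij) -/L -EL -EL0 /rel_norm.
set X := min_coset_reps _ (par (below _ _)).
have -> : min_coset_reps (par (j |: L)) (par L) =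
    (1%g |: [set (simple j * d)%g | d in X])%SET.
  apply/setP=> d; apply/idP/setU1P => [/(reps_top d Lj)[->|[d' dX ->]]|h].
  - by left.
  - by right; apply: imset_f.
  apply/(reps_top d Lj); case: h => [->|/imsetP[d' dX ->]]; [by left | right].
  by exists d'.
have jL : j \notin L by apply/negP=> /Lj; rewrite ltnn.
have aj d : d \in X -> asc j d by move=> /mem_reps[dL _]; apply: asc_notin dL.
rewrite big_setU1 /=; last first.
  apply/imsetP=> -[d dX e]; have := aj _ dX; rewrite -[d](simple_mulK j) -e asc_simple.
  by rewrite /asc !perm1 /= ltnS leqnn.
rewrite invg1 (basis_elt1 relT) mul1r mulr1; congr (_ + _).
rewrite big_imset /=; last by move=> a b _ _; apply: mulgI.
rewrite mulr_sumr mulr_suml; apply: eq_bigr => d dX.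
have [dL _] := (mem_reps _ _ _).1 dX.
have cd x : x \in par L -> Tw x * T i = T i * Tw x.
  move=> xL; have := cone_basis T xL; apply: comm_cone => // l lL.
  by rewrite (far_pred ij lL).
have e1 : Tw (simple j * d)%g = T j * Tw d by rewrite (T_basis_asc relT) // aj.
have e2 : Tw (simple j * d)^-1%g = Tw d^-1%g * T j.
  by rewrite invMg simpleV (basis_T_asc relT) // invgK aj.
have c1 := cd _ dL; have c2 : Tw d^-1%g * T i = T i * Tw d^-1%g.
  by apply: cd; rewrite groupV.
rewrite e1 e2 !mulrA -c2 -[RHS]mulrA -[RHS]mulrA c1 !mulrA.
by rewrite -3![in LHS]mulrA -3![in RHS]mulrA; congr (_ * _); rewrite !mulrA (T_braid relT ij).
Qed.

Lemma pred_par_below K i : par (pred_set (below K i.+1)) \subset par (below K i).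
Proof. by apply/parS/pred_below_sub. Qed.

Lemma jm_cone K i : i \in K -> cone (below K i.+1) (M K i).
Proof.
move=> iK; apply: (rel_norm_cone relT).
  by apply: subset_trans (pred_below_sub K i) _; apply: belowS.
by apply: (cone_T relT); rewrite inE iK ltnSn.
Qed.

Lemma predP K i : (exists j, j \in K /\ i = j.+1 :> nat) \/
  (forall j, j \in K -> i <> j.+1 :> nat).
Proof.
have [/exists_inP[j jK /eqP e]|] := boolP [exists j in K, i == j.+1 :> nat].
  by left; exists j.
by rewrite negb_exists_in => /forall_inP h; right=> j /h /eqP.
Qed.

Lemma jm_comm K i l : i \in K -> l \in K -> (l < i)%N -> T l * M K i = M K i * T l.
Proof.
move: {2}(nat_of_ord i) (leqnn i) => N; elim: N i l => [|N IH] i l iN iK lK li; first by lia.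
have [[j [jK ij]]|hi] := predP K i; last first.
  by rewrite jm_iso //; apply: (T_far relT); have := hi _ lK; lia.
rewrite (jm_rec iK jK ij); have [lj|lj] := ltnP l j.
  have cl : T l * T i = T i * T l by apply: (T_far relT); lia.
  rewrite mulrDr mulrDl cl !mulrA cl; congr (_ + _).
  by rewrite -[T i * T l * _]mulrA IH //; [rewrite -!mulrA cl | lia].
have -> : l = j by apply: val_inj => /=; lia.
have ji : T j * T i * T j = T i * T j * T i by apply: (T_braid relT).
have base : T j * (T i + T i * T j * T i) = (T i + T i * T j * T i) * T j.
  have h1 : T j * (T j * T i * T j) = T i * T j + 'X *: (T j * T i * T j).
    by rewrite !mulrA (T_sqr relT) !mulrDl mul1r -!scalerAl.
  have h2 : T j * T i * T j * T j = T j * T i + 'X *: (T j * T i * T j).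
    by rewrite -mulrA (T_sqr relT) mulrDr mulr1 -scalerAr.
  by rewrite mulrDr mulrDl -ji h1 h2 addrCA.
have [[k [kK jk]]|hj] := predP K j; last by rewrite jm_iso.
(* Two braid moves carry T_j through T_i T_j m T_j T_i, passing T_i over m in between. *)
rewrite (jm_rec jK kK jk); set m := M K k.
have cm : m * T i = T i * m by apply: comm_below (jm_cone kK) => //; lia.
have -> : T i + T i * (T j + T j * m * T j) * T i =
    (T i + T i * T j * T i) + T i * (T j * m * T j) * T i.
  by rewrite mulrDr mulrDl addrA.
rewrite mulrDr mulrDl base; congr (_ + _).
rewrite !mulrA ji -[T i * T j * T i * m]mulrA -cm.
rewrite -!mulrA; congr (_ * (_ * (_ * _))).
by rewrite !mulrA ji.
Qed.

(** With m = M_j, which commutes with M_i, the recursion and the quadratic relation turn both sides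
    into m + m T_i m + xi m M_i. This is the source of the centrality of eta. *)
Lemma jm_swap K i j : i \in K -> j \in K -> i = j.+1 :> nat ->
  T i * (M K j * M K i) = M K j * M K i * T i.
Proof.
move=> iK jK ij; have cM : M K j * M K i = M K i * M K j.
  have hM : cone (below K i) (M K j) by rewrite ij; exact: jm_cone.
  move: hM; apply: comm_cone => // l; rewrite inE => /andP[lK li]; exact: jm_comm.
have e := jm_rec iK jK ij; set m := M K j in e cM *.
have eL : T i * (M K i * m) = m + m * T i * m + 'X *: (M K i * m).
  rewrite e !mulrDl mulrDr !mulrA (T_sqr relT) !mulrDl !mul1r -!scalerAl.
  by rewrite addrACA -scalerDr.
have eR : m * M K i * T i = m + m * T i * m + 'X *: (m * M K i).
  rewrite e mulrDr mulrDl -!mulrA (T_sqr relT) !mulrDr !mulr1 -!scalerAr.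
  by rewrite addrACA -scalerDr.
by rewrite {1}cM eL eR cM.
Qed.

Lemma eta_cone K : cone K (eta_elt K).
Proof.
rewrite /eta_elt -par0; apply: (rel_norm_cone relT); first exact: pred_sub.
exact/cone_basis/word_enum_par.
Qed.

Lemma eta_ge K : cone K (eta_elt K - word_elt (enum K)).
Proof.
rewrite /eta_elt -par0 -basis_enum; apply: (rel_norm_ge relT); first exact: pred_sub.
exact/cone_basis/word_enum_par.
Qed.

Lemma eta0 : eta_elt set0 = 1.
Proof.
rewrite /eta_elt (_ : pred_set set0 = set0); last by apply/setP=> i; rewrite !inE.
by rewrite -par0 (rel_norm_self relT) basis_enum enum_set0 word_elt_nil.
Qed.

Definition eta_central K := forall i, i \in K -> T i * eta_elt K = eta_elt K * T i.

(** Take the norm in two stages: T_i commutes with the first group and factors out on the right;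
    then the central eta factors out on the left. Centrality is a hypothesis because it is proved by
    an induction that uses this step. *)
Lemma eta_step K i : i \in K -> eta_central (below K i) ->
  eta_elt (below K i.+1) = eta_elt (below K i) * M K i.
Proof.
move=> iK cE; rewrite {1}/eta_elt -par0 (rel_norm_trans relT _ (sub0set _) (pred_belowS K i)).
have -> : Tw (word_perm (enum (below K i.+1))) = Tw (word_perm (enum (below K i))) * T i.
  by rewrite !basis_enum enum_below // -cats1 word_elt_cat word_elt1.
rewrite (rel_norm_mulr relT); last first.
  by move=> l /pred_below_lt[_ li]; apply: (T_far relT); rewrite li.
rewrite {1}par0 -/(eta_elt _) (rel_norm_mull relT) // => l lP.
by apply: cE; apply: (subsetP (pred_below_sub _ _)).
Qed.

Lemma eta_central_below K k : eta_central (below K k).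
Proof.
move: {2}k (leqnn k) => N; elim: N k => [|N IH] k kN.
  by move=> i; rewrite inE; lia.
case: k kN => [|k] kN; first by move=> i; rewrite inE ltn0 andbF.
have [[i ik iK]|->] := belowP K k; last exact: IH.
have cE : eta_central (below K i) by apply: IH; lia.
rewrite -ik => l; rewrite (eta_step iK cE) below_cons // => /setU1P[->|lB].
  (* For T_i itself, eta is peeled twice when i-1 lies in K: the inner eta commutes with T_i, and
     T_i commutes with the product M_j M_i. *)
  have [[j [jK ij]]|hi] := predP K i; last first.
    rewrite jm_iso // mulrA; congr (_ * _); symmetry.
    apply: comm_cone (eta_cone (below K i)) => // j; rewrite inE => /andP[jK ji].
    by apply: (T_far relT); have := hi _ jK; lia.
  have cj : eta_central (below K j) by apply: IH; lia.
  have ej : eta_elt (below K i) = eta_elt (below K j) * M K j by rewrite ij; apply: eta_step.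
  have hj : eta_elt (below K j) * T i = T i * eta_elt (below K j).
    by apply: comm_below (eta_cone _) => //; lia.
  by rewrite ej -mulrA mulrA -hj -mulrA (jm_swap iK jK ij) mulrA.
rewrite mulrA cE // -!mulrA jm_comm //; first by apply: (subsetP (below_sub _ _)) lB.
by move: lB => /below_lt.
Qed.

Lemma eta_comm K i : i \in K -> T i * eta_elt K = eta_elt K * T i.
Proof. by have := @eta_central_below K n.-1 i; rewrite below_all. Qed.

Section EtaTrace.

Variable tau : H -> {poly int}.
Hypothesis tau_lin : forall (c : {poly int}) (a b : H), tau (c *: a + b) = c * tau a + tau b.
Hypothesis tau_basis : forall w : 'S_n, tau (Tw w) = (w == 1%g)%:R.

Lemma tau_mulT K i a : cone (below K i) a -> tau (a * T i) = 0.
Proof.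
move: a; apply: cone_ind => [|a b ha hb|c a c0 ha|w wK].
- by rewrite mul0r (tau0 tau_lin).
- by rewrite mulrDl (tauD tau_lin) ha hb addr0.
- by rewrite -scalerAl (tauZ tau_lin) ha mulr0.
have ni : i \notin below K i by rewrite inE ltnn andbF.
rewrite (basis_T_asc relT); last by apply: asc_notin ni _; rewrite groupV.
rewrite tau_basis; case: eqP => // e.
have := asc_notin ni wK; have -> : w = simple i.
  by apply/eqP; rewrite -[simple i]simpleV eq_mulgV1 invgK e.
by have := @asc_simple n i 1%g; rewrite mulg1 /asc !perm1 /= ltnSn => ->.
Qed.

(** In the recursion for M_i, the summand T_i contributes tau(y). The rest gives tau(y T_i m) + xi
    tau(y T_i m T_i), and the braid relation brings both to products with a single T_i, on which tau
    vanishes. *)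
Lemma tau_jm K i (y : H) : i \in K -> cone (below K i) y -> tau (y * M K i * T i) = tau y.
Proof.
move=> iK hy; have TT z : tau (z * T i * T i) = tau z + 'X * tau (z * T i).
  by rewrite -mulrA (T_sqr relT) mulrDr mulr1 -scalerAr (tauD tau_lin) (tauZ tau_lin).
have [[j [jK ij]]|hi] := predP K i; last by rewrite jm_iso // TT (tau_mulT hy) mulr0 addr0.
have hm : cone (below K i) (M K j) by rewrite ij; exact: jm_cone.
rewrite (jm_rec iK jK ij) mulrDr mulrDl (tauD tau_lin) TT (tau_mulT hy) mulr0 addr0.
rewrite !mulrA TT.
have cT h : cone (below K i) h -> cone setT h by apply: coneT.
have Ti : cone setT (T i) by apply: (cone_T relT); rewrite inE.
have h1 : tau (y * T i * M K j) = 0.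
  rewrite (tauC relT tau_lin tau_basis); [|by apply: (coneM relT) => //; apply: cT|exact: cT].
   by rewrite mulrA; apply: (@tau_mulT K i); apply: (coneM relT).
rewrite h1 add0r -[RHS]addr0; congr (_ + _); rewrite -[RHS](mulr0 'X); congr (_ * _).
rewrite /M /rel_norm mulr_sumr mulr_suml (tau_sum tau_lin) big1 // => d /mem_reps[dP _].
have dB : d \in par (below K j) by apply: (subsetP (pred_par_below _ _)) dP.
have cd w : w \in par (below K j) -> Tw w * T i = T i * Tw w.
  by move=> wB; apply: comm_below (cone_basis T wB) => //; lia.
have sub : below K j \subset below K i by apply: belowS; lia.
have ha : cone (below K i) (Tw d^-1%g).
  by apply: coneS sub _; apply: cone_basis; rewrite groupV.
have hb : cone (below K i) (Tw d) by apply: coneS sub _; apply: cone_basis.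
have hT : cone (below K i) (T j) by apply: (cone_T relT); rewrite inE jK /=; lia.
have -> : y * T i * (Tw d^-1%g * T j * Tw d) * T i =
    y * Tw d^-1%g * T j * T i * (T j * Tw d).
  rewrite -!mulrA cd // [T i * (Tw _ * _)]mulrA -cd ?groupV // -!mulrA.
  by congr (_ * (_ * _)); rewrite !mulrA (T_braid relT ij).
have h2 : cone (below K i) (T j * Tw d) by apply: (coneM relT).
have h3 : cone (below K i) (y * Tw d^-1%g * T j).
  by apply: (coneM relT) => //; apply: (coneM relT).
rewrite (tauC relT tau_lin tau_basis); [|by apply: (coneM relT) => //; apply: cT|exact: cT].
by rewrite mulrA; apply: (@tau_mulT K i); apply: (coneM relT).
Qed.

Lemma cone_enum_sub I K : I \subset K -> cone K (word_elt (enum I)).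
Proof. by move=> /subsetP IK; apply: (cone_word relT) => i; rewrite mem_enum; apply: IK. Qed.

(** Peel off the largest generator i of K. If i is in I, [tau_jm] cancels M_i against T_i; otherwise
    each term of M_i leaves a lone T_i and tau is zero. *)
Lemma tau_eta K I : I \subset K -> tau (eta_elt K * word_elt (enum I)) = (I == K)%:R.
Proof.
move: I; apply: (@below_max K (fun K => forall I, I \subset K ->
  tau (eta_elt K * word_elt (enum I)) = (I == K)%:R)) => [I|i iK IH I IS].
  rewrite subset0 => /eqP->; rewrite eqxx eta0 mul1r enum_set0 word_elt_nil.
  by rewrite -(basis_elt1 relT) tau_basis eqxx.
have cE := @eta_central_below K i; set E := eta_elt (below K i) in IH cE *.
rewrite (eta_step iK cE) -/E.
have cT h L : cone L h -> cone setT h by apply: coneT.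
have hE : cone (below K i) E by apply: eta_cone.
have Ti : cone setT (T i) by apply: (cone_T relT); rewrite inE.
have nB : i \notin below K i by rewrite inE ltnn andbF.
have [iI|iI] := boolP (i \in I); last first.
  have IB : I \subset below K i.
    apply/subsetP=> l lI; have := subsetP IS _ lI; rewrite below_cons // => /setU1P[e|//].
    by rewrite -e lI in iI.
  have -> : (I == below K i.+1) = false.
    by apply/negP=> /eqP e; rewrite e below_cons // !inE eqxx in iI.
  rewrite /M /rel_norm mulr_sumr mulr_suml (tau_sum tau_lin) big1 // => d /mem_reps[dP _].
  have dB := subsetP (pred_par_below _ _) _ dP.
  have h1 : cone (below K i) (Tw d * word_elt (enum I)).
    by apply: (coneM relT); [apply: cone_basis | apply: cone_enum_sub].
  have h2 : cone (below K i) (E * Tw d^-1%g).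
    by apply: (coneM relT) => //; apply: cone_basis; rewrite groupV.
  rewrite !mulrA -[_ * Tw d * _]mulrA.
  rewrite (tauC relT tau_lin tau_basis); [|by apply: (coneM relT) => //; apply: cT h2|exact: cT h1].
  by rewrite mulrA; apply: (@tau_mulT K i); apply: (coneM relT).
have IB : I :\ i \subset below K i.
  apply/subsetP=> l; rewrite in_setD1 => /andP[li lI].
  by have := subsetP IS _ lI; rewrite below_cons // => /setU1P[e|//]; rewrite e eqxx in li.
have e : I = i |: I :\ i by rewrite setD1K.
have -> : (I == below K i.+1) = (I :\ i == below K i).
  apply/eqP/eqP => [->|e2]; last by rewrite e e2 below_cons.
  by rewrite below_cons // setU1K.
rewrite -(IH _ IB) {1}e enum_rcons; last by move=> l /(subsetP IB) /below_lt.
rewrite -cats1 word_elt_cat word_elt1.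
have hI := cone_enum_sub IB.
have cM : word_elt (enum (I :\ i)) * M K i = M K i * word_elt (enum (I :\ i)).
  by apply: comm_cone hI => // l; rewrite inE => /andP[lK li]; apply: jm_comm.
rewrite mulrA -[E * _ * _]mulrA -cM mulrA tau_jm //.
by apply: (coneM relT).
Qed.

End EtaTrace.

End Eta.

(* The distinguished representative exchanging the two blocks of J inside the
   block of K = c |: J that contains c. *)
Section BlockSwap.
Variable n : nat.
Implicit Types (i j l : 'I_n.-1).

Lemma block_swap (J : {set 'I_n.-1}) (c : 'I_n.-1) : c \notin J ->
  exists (d : 'S_n) (c' : 'I_n.-1) (sigma : 'I_n.-1 -> 'I_n.-1),
  [/\ d \in min_coset_reps (par (c |: J)) (par J), ~~ asc c' d^-1%g,
      c' \in c |: J,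
      {in J &, injective sigma} &
      forall i, i \in J -> [/\ sigma i \in c |: J, sigma i != c' &
        (simple i * d = d * simple (sigma i))%g]].
Proof.
move=> cJ; set K := c |: J.
have cK : c \in K by rewrite !inE eqxx.
pose P (x : nat) := (x < n)%N && (blk K x == blk K c).
have bc1 : blk K c.+1 = blk K c by rewrite blkS cK.
have cn : (c.+1 < n)%N := simple_subproof2 c.
have exP : exists x, P x by exists c; rewrite /P eqxx andbT ltnW.
have boundP x : P x -> (x <= n)%N by move=> /andP[/ltnW].
have [p Pp minp] := ex_minnP exP; have [e Pe maxe] := ex_maxnP exP boundP.
have pc : (p <= c)%N by apply: minp; rewrite /P eqxx andbT ltnW.
have ce : (c < e)%N by apply: maxe; rewrite /P bc1 eqxx cn.
have en : (e < n)%N by case/andP: Pe.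
have Bin x : (p <= x <= e)%N -> blk K x = blk K c.
  move=> /andP[px xe]; have := blk_mono K px; have := blk_mono K xe.
  by case/andP: Pp => _ /eqP->; case/andP: Pe => _ /eqP->; lia.
have Bnot x : (x < n)%N -> blk K x = blk K c -> (p <= x <= e)%N.
  by move=> xn h; rewrite minp ?maxe // /P xn h eqxx.
have inK i : (p <= i < e)%N -> i \in K.
  move=> /andP[pi ie]; apply/negPn/negP=> iK; have := blkS K i; rewrite iK.
  by rewrite !Bin; lia.
have outK i : i \in K -> [|| (p <= i < e)%N, (i.+1 < p)%N | (e < i)%N].
  move=> iK; have := blkS K i; rewrite iK /= add0n => h.
  have in1 : (i < n)%N := simple_subproof1 i.
  have in2 : (i.+1 < n)%N := simple_subproof2 i.
  have [h1|h1] := eqVneq (blk K i) (blk K c).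
    have := Bnot _ in1 h1; have := Bnot _ in2; rewrite h => /(_ h1); lia.
  have n1 : ~~ (p <= i <= e)%N by apply/negP=> /Bin; apply/eqP.
  have n2 : ~~ (p <= i.+1 <= e)%N by apply/negP=> /Bin; rewrite h; apply/eqP.
  lia.
(* The points p..c are shifted to the right end of the block and c+1..e to its left end. *)
pose f (x : nat) := if (p <= x <= c)%N then (x + (e - c))%N
  else if (c < x <= e)%N then (x - (c.+1 - p))%N else x.
have fn x : (x < n)%N -> (f x < n)%N by rewrite /f; case: ifP; [|case: ifP]; lia.
have f_inj x y : f x = f y -> x = y.
  by rewrite /f; do 2!(case: ifP; [|case: ifP]); lia.
pose F (x : 'I_n) : 'I_n := Ordinal (fn x (ltn_ord x)).
have F_inj : injective F by move=> x y /(congr1 val) /= /f_inj /val_inj.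
pose d : 'S_n := perm F_inj.
have dE x : d x = f x :> nat by rewrite permE.
have f_blk x : blk K (f x) = blk K x.
  rewrite /f; case: ifP => [h|_]; first by rewrite !Bin; lia.
  by case: ifP => [h|_] //; rewrite !Bin; lia.
have dK : d \in par K by apply/parP=> x; rewrite dE f_blk.
have JK i : i \in J -> i \in K by move=> iJ; rewrite !inE iJ orbT.
have ci i : i \in J -> i != c :> nat.
  by move=> iJ; apply: contra cJ => /eqP/val_inj <-.
have fS i : i \in J -> f i.+1 = (f i).+1.
  move=> iJ; have := outK _ (JK _ iJ); have := ci _ iJ; rewrite /f.
  by do 2!(case: ifP; [|case: ifP]); lia.
have fbound i : i \in J -> (f i < n.-1)%N.
  by move=> iJ; have := fn i.+1 (simple_subproof2 i); rewrite fS //; lia.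
(* On J the value [f i] is below n-1, so the default of [insubd] never occurs there. *)
pose sigma i : 'I_n.-1 := insubd i (f i).
have sE i : i \in J -> sigma i = f i :> nat.
  by move=> iJ; rewrite /sigma val_insubd fbound.
(* This is the new junction: f e = c' and f p = c'+1, whence the descent of d^-1 at c'. *)
have c'n : (p + (e - c.+1) < n.-1)%N by lia.
exists d, (Ordinal c'n), sigma; split.
- apply/mem_reps; split=> // i iJ; rewrite /asc !dE /= fS //.
- rewrite ascN.
  have en' : (e < n)%N := en.
  have pn : (p < n)%N by lia.
  have e1 : lo (Ordinal c'n) = d (Ordinal en').
    by apply: val_inj; rewrite /= dE /= /f; case: ifP; [|case: ifP]; lia.
  have e2 : hi (Ordinal c'n) = d (Ordinal pn).
    by apply: val_inj; rewrite /= dE /= /f; case: ifP; [|case: ifP]; lia.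
  by rewrite e1 e2 !permK /=; lia.
- by apply: inK => /=; lia.
- move=> i j iJ jJ /(congr1 val) /=; rewrite !sE // => /f_inj; exact: val_inj.
move=> i iJ; split.
- have := outK _ (JK _ iJ); have := ci _ iJ => ic /or3P[h|h|h].
  + apply: inK; rewrite sE // /f; case: ifP; [|case: ifP]; lia.
  + suff -> : sigma i = i by exact: JK.
    by apply: val_inj; rewrite /= sE // /f; case: ifP; [|case: ifP]; lia.
  + suff -> : sigma i = i by exact: JK.
    by apply: val_inj; rewrite /= sE // /f; case: ifP; [|case: ifP]; lia.
- rewrite -val_eqE /= sE //; have := outK _ (JK _ iJ); have := ci _ iJ.
  by rewrite /f; case: ifP; [|case: ifP]; lia.
by apply: conj_simple; apply: val_inj; rewrite /= dE /= ?fS // sE.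
Qed.

End BlockSwap.

(** * Merging two blocks *)

Section Main.

Variables (n : nat) (H : algType {poly int}) (T : 'I_n.-1 -> H).
Hypothesis relT : hecke_relations T.
Variable tau : H -> {poly int}.
Hypothesis tau_lin : forall (c : {poly int}) (a b : H), tau (c *: a + b) = c * tau a + tau b.
Hypothesis tau_basis : forall w : 'S_n, tau (basis_elt T w) = (w == 1%g)%:R.
Implicit Types (I J K L : {set 'I_n.-1}) (i j l c : 'I_n.-1) (w d : 'S_n) (r s t : seq 'I_n.-1).
Implicit Types (a b h : H).

Notation Tw := (basis_elt T).
Notation cone := (cone T).
Notation word_elt := (word_elt T).
Notation norm K J := (rel_norm T (par K) (par J)).
Notation eta_elt := (eta_elt T).

Lemma word_conj (J : {set 'I_n.-1}) (sigma : 'I_n.-1 -> 'I_n.-1) d s :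
  {subset s <= J} -> (forall i, i \in J -> asc i d) ->
  (forall i, i \in J -> (simple i * d = d * simple (sigma i))%g) ->
  word_elt s * Tw d = Tw d * word_elt (map sigma s).
Proof.
move=> sJ aJ cJ; elim: s sJ => [|i s IH] sJ.
  by rewrite !word_elt_nil mul1r mulr1.
have iJ : i \in J by apply: sJ; rewrite inE eqxx.
rewrite map_cons !word_elt_cons -mulrA IH; last first.
  by move=> j js; apply: sJ; rewrite inE js orbT.
by have [e _] := basis_conj relT (aJ _ iJ) (cJ _ iJ); rewrite mulrA e mulrA.
Qed.

(** Write w = v s_i. Then T_{w^-1} T_w = T_i (T_{v^-1} T_v) T_i dominates T_i^2 = 1 + xi T_i. *)
Lemma basis_inv_geX K i w : w \in par K -> i \in K -> ~~ asc i w^-1%g ->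
  cone K (Tw w^-1%g * Tw w - 'X *: T i).
Proof.
move=> wK iK ni; pose v := (w * simple i)%g.
have ev : (v^-1 = simple i * w^-1)%g by rewrite invMg simpleV.
have av : asc i v^-1%g by rewrite ev asc_simple.
have vK : v \in par K by rewrite groupM ?simple_par.
have e1 : Tw w = Tw v * T i by rewrite (basis_T_asc relT av) /v -mulgA simpleK mulg1.
have e2 : Tw w^-1%g = T i * Tw v^-1%g.
  by rewrite (T_basis_asc relT av) ev simple_mulK.
have hT : cone K (T i) by apply: (cone_T relT).
have -> : Tw w^-1%g * Tw w - 'X *: T i = T i * (Tw v^-1%g * Tw v - 1) * T i + 1.
  rewrite e1 e2 mulrBr mulrBl mulr1 (T_sqr relT) !mulrA.
  by rewrite opprD addrA addrAC subrK.
apply: coneD; last exact: (cone1 relT).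
by apply: (coneM relT) => //; apply: (coneM relT) => //; apply: (basis_inv_ge1 relT).
Qed.

Lemma norm_eta_cone J K : J \subset K -> cone K (norm K J (eta_elt J)).
Proof. by move=> JK; apply: (rel_norm_cone relT) => //; apply: coneS JK (eta_cone relT J). Qed.

Lemma norm_eta_comm J K i : i \in K ->
  T i * norm K J (eta_elt J) = norm K J (eta_elt J) * T i.
Proof. by apply: (rel_norm_comm relT) => j; apply: (eta_comm relT). Qed.

(* For the block swap d, T_{d^-1} T_{w_J} T_d = T_{d^-1} T_d T_s with s the word
   sigma(w_J), and T_{d^-1} T_d - xi T_c' is nonnegative. *)
Lemma norm_eta_coxeter J c : c \notin J -> exists s,
  [/\ uniq s, s =i c |: J
    & cone (c |: J) (norm (c |: J) J (eta_elt J) - 'X *: word_elt s)].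
Proof.
move=> cJ; have [d [c' [sigma [dX nc' c'K s_inj hs]]]] := block_swap cJ.
set K := c |: J in dX c'K hs *; have [dK dJ] := (mem_reps _ _ _).1 dX.
have JK : J \subset K by apply: subsetUr.
pose s := c' :: map sigma (enum J); exists s.
have us : uniq s.
  rewrite /= map_inj_in_uniq ?enum_uniq ?andbT; last first.
    by move=> i j; rewrite !mem_enum; apply: s_inj.
  apply/mapP=> -[i]; rewrite mem_enum => /hs[_ ni _] e.
  by rewrite e eqxx in ni.
have sK : {subset s <= K}.
  move=> i; rewrite inE => /orP[/eqP->//|/mapP[j]].
  by rewrite mem_enum => /hs[h _ _] ->.
have sE : s =i K.
  have sub : {subset s <= enum K} by move=> i /sK; rewrite mem_enum.
  have [|_ h] := uniq_min_size us sub; last by move=> i; rewrite h mem_enum.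
  by rewrite /= size_map -!cardE cardsU1 cJ.
split=> //.
have hE := coneS JK (eta_cone relT J).
have hd : cone K (Tw d) by apply: cone_basis.
have hdV : cone K (Tw d^-1%g) by apply: cone_basis; rewrite groupV.
(* The three nonnegative remainders: the other representatives, the rest of eta_J, and what T_{d^-1}
   T_d has beyond xi T_c'. *)
pose A := norm K J (eta_elt J) - Tw d^-1%g * eta_elt J * Tw d.
pose B := Tw d^-1%g * (eta_elt J - word_elt (enum J)) * Tw d.
pose C := (Tw d^-1%g * Tw d - 'X *: T c') * word_elt (map sigma (enum J)).
have -> : norm K J (eta_elt J) - 'X *: word_elt s = A + B + C.
  rewrite /A /B /C mulrBr mulrBl addrA subrK mulrBl word_elt_cons scalerAl addrA.
  rewrite -[Tw d^-1%g * _ * Tw d]mulrA (word_conj (sigma := sigma) (J := J)) //.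
  - by rewrite !mulrA subrK.
  - by move=> i; rewrite mem_enum.
  - by move=> i /hs[].
apply: coneD; first apply: coneD.
- exact: (rel_norm_term relT).
- apply: (coneM relT) => //; apply: (coneM relT) => //.
  by apply: coneS JK _; apply: (eta_ge relT).
- apply: (coneM relT); first exact: basis_inv_geX.
  apply: (cone_word relT) => i /mapP[j]; rewrite mem_enum => /hs[h _ _] -> //.
Qed.

Lemma phi_word0 K h s : cone K h -> (forall i, i \in K -> T i * h = h * T i) ->
  uniq s -> s =i K -> tau (h * word_elt s) = tau (h * word_elt (enum K)).
Proof.
move=> hK hC us sK.
have c0 i : i \in K -> T i * 0 = 0 * T i by rewrite mulr0 mul0r.
have := @phi_word n H T relT tau tau_lin tau_basis K h 0 hK (cone0 T K) hC c0 s us.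
rewrite subr0 (_ : [set i in s] = K); last by apply/setP=> i; rewrite inE sK.
by apply=> i; rewrite sK.
Qed.

Lemma tau_word_rev s : nneg (tau (word_elt s * word_elt (rev s)) - 1).
Proof.
have h : cone setT (word_elt s * word_elt (rev s) - 1).
  by apply: (word_rev_ge1 relT) => i; rewrite inE.
have := tau_nneg tau_lin tau_basis h.
by rewrite (tauB tau_lin) -[X in tau _ - tau X](basis_elt1 relT) tau_basis eqxx.
Qed.

Definition norm_diff J c : H := norm (c |: J) J (eta_elt J) - 'X *: eta_elt (c |: J).

Lemma norm_diff_cone J c : c \notin J -> cone (c |: J) (norm_diff J c).
Proof.
move=> cJ; set K := c |: J; have JK : J \subset K by apply: subsetUr.
have hN := norm_eta_cone JK.
have cT h : cone K h -> cone setT h by apply: coneT.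
have hX : cone K ('X *: eta_elt K) by apply: coneZ; [exact: nnegX | exact: (eta_cone relT)].
apply: (cone_central relT tau_lin tau_basis hN hX) => [i|i iK|I IK].
- exact: norm_eta_comm.
- by rewrite -scalerAl -scalerAr (eta_comm relT).
rewrite mulrBl (tauB tau_lin) -scalerAl (tauZ tau_lin).
rewrite (tau_eta relT tau_lin tau_basis IK).
have [->|_] := eqVneq I K; last first.
  rewrite mulr0 subr0; apply: (tau_nneg tau_lin tau_basis); apply: cT.
  by apply: (coneM relT) => //; apply: (cone_enum_sub relT).
rewrite mulr1; have [s [us sK hs]] := norm_eta_coxeter cJ.
(* The increasing word of K may be exchanged for [rev s], against which the summand xi T_s
   contributes at least xi; this pays for xi tau(eta_K T_K) = xi. *)
have ru : uniq (rev s) by rewrite rev_uniq.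
have rK : rev s =i K by move=> i; rewrite mem_rev sK.
rewrite -(phi_word0 hN _ ru rK); last by move=> i; apply: norm_eta_comm.
rewrite -[norm K J _](subrK ('X *: word_elt s)) mulrDl (tauD tau_lin) -scalerAl.
rewrite (tauZ tau_lin) -addrA -[X in _ + (_ - X)]mulr1 -mulrBr.
apply: nnegD; last by apply: nnegM; [exact: nnegX | exact: tau_word_rev].
apply: (tau_nneg tau_lin tau_basis); apply: cT; apply: (coneM relT) => //.
by apply: (cone_word relT) => i; rewrite rK.
Qed.

(** Otherwise the norm would pair with T_J as xi eta_K does, that is to zero, and likewise with the
    reversed word of J. But it contains T_J, which pairs with that reversed word to at least 1. *)
Lemma norm_diff_neq0 J c : c \notin J -> norm_diff J c <> 0.
Proof.
move=> cJ e; set K := c |: J in e; have JK : J \subset K by apply: subsetUr.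
have hN := norm_eta_cone JK.
have cT h : cone K h -> cone setT h by apply: coneT.
have hJr : cone K (word_elt (rev (enum J))).
  by apply: (cone_word relT) => i; rewrite mem_rev mem_enum; apply: (subsetP JK).
have t0 : tau (norm K J (eta_elt J) * word_elt (enum J)) = 0.
  have := tau_eta relT tau_lin tau_basis JK.
  have -> : (J == K) = false by apply/eqP=> eJ; rewrite eJ !inE eqxx in cJ.
  move=> tE; have := congr1 (fun h => tau (h * word_elt (enum J))) e.
  rewrite /norm_diff -/K mulrBl (tauB tau_lin) -scalerAl (tauZ tau_lin) tE mulr0 subr0 => ->.
  by rewrite mul0r (tau0 tau_lin).
have t1 : tau (norm K J (eta_elt J) * word_elt (rev (enum J))) = 0.
  have c0 i : i \in K -> T i * 0 = 0 * T i by rewrite mulr0 mul0r.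
  have cN i : i \in K -> T i * norm K J (eta_elt J) = norm K J (eta_elt J) * T i.
    exact: norm_eta_comm.
  have := @phi_word n H T relT tau tau_lin tau_basis K _ 0 hN (cone0 T K) cN c0
    (rev (enum J)).
  rewrite subr0 (_ : [set i in _] = J) ?t0; last by apply/setP=> i; rewrite inE mem_rev mem_enum.
  apply; first by rewrite rev_uniq enum_uniq.
  by move=> i; rewrite mem_rev mem_enum; apply: (subsetP JK).
pose A := norm K J (eta_elt J) - word_elt (enum J).
have hA : cone K A.
  rewrite /A -(subrK (eta_elt J) (norm K J (eta_elt J))) -addrA; apply: coneD.
    by apply: (rel_norm_ge relT) => //; apply: coneS JK (eta_cone relT J).
  by apply: coneS JK (eta_ge relT J).
have n1 : nneg (tau (A * word_elt (rev (enum J)))).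
  by apply: (tau_nneg tau_lin tau_basis); apply: cT; apply: (coneM relT).
have := nnegD n1 (tau_word_rev (enum J)).
rewrite /A mulrBl (tauB tau_lin) t1 addrA sub0r addNr add0r.
by move/nnegP/(_ 0%N); rewrite coefN coef1.
Qed.

Definition subset_b J : H := norm setT J (eta_elt J).

(** By transitivity the difference is the norm of [norm_diff J c]; it is nonzero because the norm of
    a nonnegative element dominates that element. *)
Lemma subset_b_step J c : c \notin J ->
  cone setT (subset_b J - 'X *: subset_b (c |: J)) /\
  subset_b J - 'X *: subset_b (c |: J) <> 0.
Proof.
move=> cJ; set K := c |: J; have JK : J \subset K by apply: subsetUr.
have hD := coneT (norm_diff_cone cJ).
have -> : subset_b J - 'X *: subset_b K = norm setT K (norm_diff J c).
  rewrite /subset_b (rel_norm_trans relT _ JK (subsetT K)).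
  by rewrite /norm_diff rel_normB rel_normZ.
split; first exact: (rel_norm_cone relT).
move=> e; apply: (norm_diff_neq0 cJ).
apply: (cone_add_eq0 relT tau_lin tau_basis hD (rel_norm_ge relT K (subxx _) hD)).
by rewrite addrC subrK.
Qed.

Lemma subset_b_lt m J K : J \subset K -> #|K :\: J| = m.+1 ->
  cone setT (subset_b J - 'X ^+ m.+1 *: subset_b K) /\
  subset_b J - 'X ^+ m.+1 *: subset_b K <> 0.
Proof.
elim: m J => [|m IH] J JK hm.
  have /cards1P[c ec] : #|K :\: J| == 1%N by rewrite hm.
  have eK : K = c |: J.
    by rewrite -ec setDE setUC setUIr setUCr setIT; apply/esym/setUidPr.
  have cJ : c \notin J.
    by have : c \in K :\: J; [rewrite ec !inE | rewrite inE => /andP[]].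
  by rewrite eK expr1; apply: subset_b_step.
have [c] : exists c, c \in K :\: J by apply/card_gt0P; rewrite hm.
rewrite inE => /andP[cJ cK].
have JK' : c |: J \subset K by rewrite subUset sub1set cK.
have hm' : #|K :\: (c |: J)| = m.+1.
  have := cardsD1 c (K :\: J); rewrite hm !inE cJ cK /= add1n => -[->].
  by congr #|pred_of_set _|; apply/setP=> i; rewrite !inE negb_or andbA.
have [h1 h1'] := IH _ JK' hm'; have [h2 h2'] := subset_b_step cJ.
have h3 := coneZ nnegX h1.
have -> : subset_b J - 'X ^+ m.+2 *: subset_b K =
  (subset_b J - 'X *: subset_b (c |: J)) +
  'X *: (subset_b (c |: J) - 'X ^+ m.+1 *: subset_b K).
  by rewrite scalerBr scalerA -exprS addrA subrK.
split; first exact: coneD.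
by move=> e; apply: h2'; apply: (cone_add_eq0 relT tau_lin tau_basis h2 h3 e).
Qed.

Lemma subset_b_cone J : cone setT (subset_b J).
Proof. by apply: (rel_norm_cone relT) => //; apply/coneT/(eta_cone relT). Qed.

End Main.

(** * Compositions *)

Section CompositionSets.

Implicit Types (l m b : seq nat) (i a : nat).

(** A recursive form of [in_factor], so that concatenation and refinement can be treated by
    induction on the list. *)
Fixpoint in_gen l i : bool :=
  if l is a :: l' then (if (i < a)%N then (i.+1 < a)%N else in_gen l' (i - a)%N) else false.

Lemma in_genP l i :
  reflect (exists2 k, (k < size l)%N & in_factor l k i) (in_gen l i).
Proof.
elim: l i => [|a l IH] i /=; first by constructor=> -[].
have S k : psum (a :: l) k.+1 = (a + psum l k)%N by [].
have e0 : in_factor (a :: l) 0 i = (i < a.-1)%N.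
  by rewrite /in_factor S /psum !take0 /=; lia.
have eS k : in_factor (a :: l) k.+1 i = (a <= i)%N && in_factor l k (i - a)%N.
  by rewrite /in_factor !S; lia.
case: ltnP => ia.
  apply: (iffP idP) => [h|[[|k] _]]; first by exists 0%N; rewrite // e0; lia.
    by rewrite e0; lia.
  by rewrite eS; lia.
apply: (iffP (IH _)) => [[k kl h]|[[|k] kl]].
- by exists k.+1; rewrite // eS ia.
- by rewrite e0; lia.
- by rewrite eS ia; exists k.
Qed.

Lemma in_gen_lt l i : in_gen l i -> (i.+1 < sumn l)%N.
Proof.
elim: l i => //= a l IH i; case: ltnP => ia; first by lia.
by move/IH; lia.
Qed.

Lemma in_gen_cat b l i :
  in_gen (b ++ l) i = if (i < sumn b)%N then in_gen b i else in_gen l (i - sumn b)%N.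
Proof.
elim: b i => [|a b IH] i /=; first by rewrite subn0.
rewrite IH subnDA; case: ltnP => ia; first by rewrite ltn_addr.
by rewrite ltn_subLR.
Qed.

(** Splitting a part a into a-1, 1 deletes its last generator, and a generator i is not the last of
    its part exactly when i+1 is a generator too. *)
Lemma in_gen_pred l i : in_gen (comp_pred l) i = in_gen l i && in_gen l i.+1.
Proof.
rewrite /comp_pred; elim: l i => [//|a l IH] i.
rewrite [flatten _]/= in_gen_cat [in RHS]/=.
case: (ltnP 1 a) => a1 /=.
  case: (ltnP i (a.-1 + (1 + 0))) => h.
    have -> : (i < a)%N by lia.
    case: (ltnP i a.-1) => h2; last by have -> : (i.+1 < a)%N = false; [|case: ifP]; lia.
    by have -> : (i.+1 < a)%N; lia.
  have [-> ->] : (i < a)%N = false /\ (i.+1 < a)%N = false by lia.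
  by rewrite IH; congr (in_gen _ _ && in_gen _ _); lia.
rewrite addn0; case: ltnP => h; first by have -> : (i.+1 < a)%N = false; lia.
have -> : (i.+1 < a)%N = false by lia.
by rewrite IH subSn.
Qed.

Lemma in_gen_refines l m i : refines l m -> in_gen l i -> in_gen m i.
Proof.
case=> bs [_ -> ->]; elim: bs i => //= b bs IH i; rewrite in_gen_cat.
by case: ltnP => ib; [exact: in_gen_lt | exact: IH].
Qed.

Lemma in_gen_inj l m : all (leq 1) l -> all (leq 1) m -> sumn l = sumn m ->
  in_gen l =1 in_gen m -> l = m.
Proof.
elim: l m => [|a l IH] [|b m] //=; try by case/andP; lia.
  by move=> _ /andP[]; lia.
move=> /andP[a1 l1] /andP[b1 m1] e h.
(* The first missing generator is at index a-1, so the generators determine the first part. *)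
have ab : a = b.
  have [ab|ab|//] := ltngtP a b.
    by have := h a.-1; rewrite /= prednK // !leqnn ltnn (ltnW ab) ab.
  by have := h b.-1; rewrite /= prednK // !leqnn ltnn (ltnW ab) ab.
rewrite -ab in e h *; congr cons; apply: IH => // [|i]; first by lia.
by have := h (a + i)%N; rewrite /= ltnNge leq_addr /= addKn.
Qed.

End CompositionSets.

Section CompositionGens.

Variable n : nat.
Implicit Types (l m : seq nat).

Definition gens l : {set 'I_n.-1} := [set i : 'I_n.-1 | in_gen l i].

Lemma parabolicE l : parabolic n l = par (gens l).
Proof.
rewrite /parabolic /par /=; congr generated; apply/setP=> w.
have e (i : 'I_n.-1) : [exists k : 'I_(size l), in_factor l k i] = in_gen l i.
  apply/existsP/in_genP => [[k h]|[k kl h]]; first by exists k.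
  by exists (Ordinal kl).
by apply/imsetP/imsetP => -[i ih ->]; exists i => //; move: ih; rewrite !inE e.
Qed.

Lemma enum_setU (A B : {set 'I_n.-1}) : (forall i j, i \in A -> j \in B -> (i < j)%N) ->
  enum (A :|: B) = enum A ++ enum B.
Proof.
move=> AB; have tr : transitive (fun i j : 'I_n.-1 => (i < j)%N).
  by move=> a b c /=; apply: ltn_trans.
apply: (@irr_sorted_eq _ (fun i j : 'I_n.-1 => (i < j)%N)) => //.
- by move=> a /=; rewrite ltnn.
- exact: enum_ord_sorted.
- rewrite sorted_pairwise // pairwise_cat -!sorted_pairwise // !enum_ord_sorted !andbT.
  by apply/allrelP=> i j; rewrite !mem_enum; apply: AB.
- by move=> i; rewrite mem_cat !mem_enum inE.
Qed.

Lemma psum_mono l (k k' : nat) : (k <= k')%N -> (psum l k <= psum l k')%N.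
Proof.
by move=> kk; rewrite /psum -(subnKC kk) takeD sumn_cat leq_addr.
Qed.

(** The factors occupy successive ranges of indices, so the product over the parts is one increasing
    product. *)
Lemma comp_permE l : comp_perm n l = word_perm (enum (gens l)).
Proof.
pose G (m : nat) := [set i : 'I_n.-1 | [exists k : 'I_m, in_factor l k i]].
have -> : gens l = G (size l).
  apply/setP=> i; rewrite !inE; apply/in_genP/existsP => [[k kl h]|[k h]].
    by exists (Ordinal kl).
  by exists k.
rewrite /comp_perm; elim: (size l) => [|m IH].
  rewrite big_ord0 (_ : G 0%N = set0) ?enum_set0 /word_perm ?big_nil //.
  by apply/setP=> i; rewrite !inE; apply/existsP=> -[[]].
pose F := [set i : 'I_n.-1 | in_factor l m i].
rewrite big_ord_recr /= IH.
have -> : G m.+1 = G m :|: F.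
  apply/setP=> i; rewrite !inE; apply/existsP/orP => [[k h]|[/existsP[k h]|h]].
  - have := ltn_ord k; rewrite ltnS leq_eqVlt => /orP[/eqP e|km].
      by right; rewrite -e.
    by left; apply/existsP; exists (Ordinal km).
  - by exists (widen_ord (leqnSn m) k).
  - by exists ord_max.
rewrite enum_setU; last first.
  move=> i j; rewrite !inE => /existsP[k]; rewrite /in_factor => h1 h2.
  by have := psum_mono l (ltn_ord k); lia.
rewrite word_perm_cat; congr (_ * _)%g; rewrite /word_perm.
have -> : enum F = [seq i <- index_enum _ | i \in F] by rewrite [index_enum _]unlock.
rewrite big_filter.
by apply: eq_bigl => i; rewrite inE.
Qed.

Lemma comp_lengthE l : comp_length n l = #|gens l|.
Proof. by rewrite /comp_length comp_permE length_enum. Qed.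

Lemma gens_pred l : is_composition n l -> gens (comp_pred l) = pred_set (gens l).
Proof.
move=> /andP[_ /eqP ln]; apply/setP=> i; rewrite !inE in_gen_pred.
congr andb; apply/idP/exists_inP => [h|[j]]; last by rewrite inE => jl /eqP <-.
have iS : (i.+1 < n.-1)%N by have := in_gen_lt h; rewrite ln; lia.
by exists (Ordinal iS); rewrite ?inE.
Qed.

Lemma refines_gens l m : refines l m -> gens l \subset gens m.
Proof. by move=> lm; apply/subsetP=> i; rewrite !inE; apply: in_gen_refines. Qed.

Lemma gens_inj l m : is_composition n l -> is_composition n m -> gens l = gens m -> l = m.
Proof.
move=> /andP[l1 /eqP ln] /andP[m1 /eqP mn] e; apply: in_gen_inj => // [|i].
  by rewrite ln mn.
have [h|h] := ltnP i n.-1; first by have /setP/(_ (Ordinal h)) := e; rewrite !inE.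
by apply/idP/idP => /in_gen_lt; rewrite ?ln ?mn; lia.
Qed.

Lemma hecke_etaE (H : algType {poly int}) (T : 'I_n.-1 -> H) l :
  is_composition n l -> hecke_eta T l = eta_elt T (gens l).
Proof. by move=> lc; rewrite /hecke_eta parabolicE gens_pred // comp_permE. Qed.

Lemma hecke_bE (H : algType {poly int}) (T : 'I_n.-1 -> H) l :
  is_composition n l -> hecke_b T l = subset_b T (gens l).
Proof. by move=> lc; rewrite /hecke_b hecke_etaE // parabolicE /subset_b parT. Qed.

End CompositionGens.

Theorem theorem7p2 (n : nat) (H : algType {poly int}) (T : 'I_n.-1 -> H)
    (hT : is_hecke_algebra T) (l m : seq nat)
    (hl : is_composition n l) (hm : is_composition n m)
    (hlm : strictly_refines l m) :
  hecke_lt T ('X ^+ (comp_length n m - comp_length n l) *: hecke_b T m)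
             (hecke_b T l).
Proof.
have [tau [tau_lin tau_basis]] := trace_exists hT.
have [relT _] := hT; have [rlm nlm] := hlm.
have sub := refines_gens n rlm.
have hk : #|gens n m :\: gens n l| = (comp_length n m - comp_length n l)%N.
  by rewrite !comp_lengthE cardsD (setIidPr sub).
(* A zero exponent would give equal sets of generators, hence equal compositions. *)
case k_def : (comp_length n m - comp_length n l)%N => [|k].
  case: nlm; apply: (gens_inj hl hm); apply/eqP; rewrite eqEsubset sub.
  by rewrite -setD_eq0 -cards_eq0 hk k_def.
have [h1 h2] := subset_b_lt relT tau_lin tau_basis sub (etrans hk k_def).
rewrite !hecke_bE //; split; last first.
  by move=> e; apply: h2; rewrite e subrr.
have bc J := (cone_nneg T _).1 (subset_b_cone relT J).
split; [|exact: bc|exact/cone_nneg].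
apply/cone_nneg/coneZ; last exact: subset_b_cone.
by elim: k.+1 => [|j IH]; rewrite ?expr0 ?exprS; [exact: nneg1 | apply: nnegM; first exact: nnegX].
Qed.
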